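(* For integers $i\ge 1$ and $n\ge 2$, let $F(i,n)$ denote the number of sibling portraits of an $n$-gon $P$ in a round gap $R$ of degree $i$ with $P\subset\sigma_d(R)$, and let $f(i,n)$ denote the number of those sibling portraits all of whose polygons map one-to-one onto $P$. Then $$F(i,n)=f(i,n+1),$$ i.e. the number of all sibling portraits of an $n$-gon in a round gap of degree $i$ equals the number of sibling portraits of an $(n+1)$-gon in a round gap of degree $i$ in which every polygon maps one-to-one.
   Context: The circle $\mathbb S=\mathbb R/\mathbb Z$ is the boundary of the closed unit disk; $\sigma_d(\theta)=d\theta\bmod 1$, $d\ge2$. A lamination is a closed set of chords of the unit disk that do not cross except possibly at endpoints, together with all points of the circle; leaves are its nondegenerate chords. A round gap is the closure of a component of the complement of a lamination that has arcs of the circle in its boundary; the empty lamination has one round gap, the whole disk (which has degree $d$). The map $\sigma_d$ acts on chords through endpoints, on arcs pointwise, and on a region bounded by arcs and leaves by sending it to the region bounded by the images of the parts of its boundary. A round gap $R$ has degree $i$ if $\sigma_d|_{\mathrm{Bd}(R)}$ is a positively oriented covering map of degree $i$. A polygon ($n$-gon) is the convex hull of a finite set of $n\ge 2$ points of the circle; a lone leaf is a 2-gon and is regarded as having two sides (one from $a$ to $b$ and one from $b$ to $a$). The image of a polygon is the convex hull of the images of its vertices. Given a round gap $R$ of degree $i$ and a polygon $P$ contained in $\sigma_d(R)$, a sibling portrait (of $P$ in $R$) is a set of pairwise disjoint polygons (disjoint even at vertices) inside $R$ that map to $P$ and which together have exactly $i$ sides mapping to each side of $P$. The numbers $F$ and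 $f$ depend only on $i$ and $n$. *)

(* Defs.v *)
From HB Require Import structures.
From mathcomp Require Import all_boot all_order all_algebra finmap.
From mathcomp Require Import all_classical all_reals all_analysis.
From mathcomp Require Import ring lra.

Set Implicit Arguments.
Unset Strict Implicit.
Unset Printing Implicit Defensive.

Import Order.TTheory GRing.Theory Num.Theory.
Import numFieldNormedType.Exports.

Local Open Scope classical_set_scope.
Local Open Scope ring_scope.

Notation plane R := (R^o * R^o)%type.

Section Plane.
Variable R : realType.
Implicit Types (a b c x y : plane R) (A X Y U : set (plane R)).

Definition unit_disk : set (plane R) := [set x | x.1 ^+ 2 + x.2 ^+ 2 <= 1].
Definition unit_circle : set (plane R) := [set x | x.1 ^+ 2 + x.2 ^+ 2 = 1].

Definition boundary A : set (plane R) := closure A `\` A°.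

Definition convex_hull A : set (plane R) :=
  smallest (@convex_set R (plane R)) A.

Definition chord a b : set (plane R) :=
  [set x | exists2 t : R, 0 <= t <= 1 & x = (1 - t) *: a + t *: b].

(* Twice the signed area of the triangle abc: positive iff c lies strictly to
   the left of the directed line from a to b. For points of the unit circle,
   this says that a, b, c are distinct and in counterclockwise order. *)
Definition orient a b c : R :=
  (b.1 - a.1) * (c.2 - a.2) - (b.2 - a.2) * (c.1 - a.1).

(* The closed region bounded by a closed curve Y. *)
Definition filled Y : set (plane R) :=
  Y `|` [set x | ~ Y x /\ bounded_set (connected_component (~` Y) x)].

Definition homeomorphism_on (f : plane R -> plane R) X Y : Prop :=
  exists g : plane R -> plane R,
    [/\ {within X, continuous f}, {within Y, continuous g},
        f @` X `<=` Y, g @` Y `<=` X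
      & (forall x, X x -> g (f x) = x) /\ (forall y, Y y -> f (g y) = y)].

(* f restricts to a covering map from X onto Y with i sheets. *)
Definition covering_map (i : nat) (f : plane R -> plane R) X Y : Prop :=
  [/\ {within X, continuous f}, f @` X = Y
    & forall y, Y y -> exists U, [/\ open U, U y
      & exists V : 'I_i -> set (plane R),
        [/\ forall k, open (V k),
            trivIset setT (fun k => X `&` V k),
            X `&` f @^-1` U = \bigcup_k (X `&` V k)
          & forall k, homeomorphism_on f (X `&` V k) (Y `&` U)]]].

(* g is a counterclockwise parametrization, by R / Z, of the simple closed
   curve X. The curves of interest bound convex regions, so that
   counterclockwise means that no three successive points make a right turn
   (they may be collinear, because X may contain segments). *)
Definition ccw_parametrization (g : R -> plane R) X : Prop :=
  [/\ continuous g,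
      periodic g 1,
      g @` `[0, 1[ = X,
      {in `[0, 1[ &, injective g}
    & forall t1 t2 t3, t1 < t2 -> t2 < t3 -> t3 < t1 + 1 ->
        0 <= orient (g t1) (g t2) (g t3)].

(* In counterclockwise parameters, f is given by an increasing function. *)
Definition positively_oriented (f : plane R -> plane R) X Y : Prop :=
  exists (g h : R -> plane R) (F : R -> R),
    [/\ ccw_parametrization g X, ccw_parametrization h Y,
        continuous F, {homo F : s t / s < t}
      & forall t, f (g t) = h (F t)].

End Plane.

Arguments unit_disk {R}.
Arguments unit_circle {R}.

Section Circle.
Variable R : realType.
Implicit Types (t : R) (x : plane R).

(* The identification of R / Z with the unit circle. *)
Definition circ t : plane R := (cos (2 * pi * t), sin (2 * pi * t)).

Definition angle x : R := xget 0 [set t | 0 <= t < 1 /\ circ t = x].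

Definition sigma (d : nat) x : plane R := circ (d%:R * angle x).

Lemma circ_periodic : periodic circ 1.
Proof.
move=> t; rewrite /circ mulrDr mulr1 (_ : 2 * pi = pi *+ 2); last first.
  by rewrite mulr_natl.
by rewrite cosD2pi sinD2pi.
Qed.

Lemma circDz t (k : int) : circ (t + k%:~R) = circ t.
Proof.
case: k => m; first by rewrite periodicn //; exact: circ_periodic.
rewrite NegzE mulrNz -{2}(subrK m.+1%:R t) -[X in circ (t - X)]/(m.+1%:R).
by rewrite (periodicn circ_periodic).
Qed.

Lemma circ_inj t u : circ t = circ u -> exists k : int, t = u + k%:~R.
Proof.
move=> tu; pose k := Num.floor (t - u).
have /andP[k0 k1] : 0 <= t - u - k%:~R < 1.
  have := Num.Theory.floor_le (t - u); have := floorD1_gt (t - u).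
  rewrite -/k intrD /= => h1 h2; apply/andP; split; lra.
exists k; have : cos (2 * pi * (t - u - k%:~R)) = 1.
  have /esym := circDz (t - k%:~R) k; rewrite subrK tu => -[hc hs].
  rewrite (_ : _ * _ = 2 * pi * (t - k%:~R) - 2 * pi * u); last by ring.
  by rewrite cosB -hc -hs -!expr2 cos2Dsin2.
set w := _ - _ - _ in k0 k1 *; move=> cw.
suff : w = 0 by rewrite /w; lra.
have pi0 := pi_gt0 R.
have [le_w|lt_w] := leP w (1 / 2).
  have : acos (cos (2 * pi * w)) = 2 * pi * w.
    by rewrite cosK // in_itv /=; apply/andP; split; nra.
  by rewrite cw acos1 => /esym/eqP; rewrite mulf_eq0 => /orP[|/eqP //]; nra.
have cw' : cos (2 * pi - 2 * pi * w) = 1.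
  by rewrite cosB cw mulr_natl cos2pi sin2pi; ring.
have : acos (cos (2 * pi - 2 * pi * w)) = 2 * pi - 2 * pi * w.
  by rewrite cosK // in_itv /=; apply/andP; split; nra.
by rewrite cw' acos1; nra.
Qed.

Lemma sigma_circ d t : sigma d (circ t) = circ (d%:R * t).
Proof.
rewrite /sigma /angle; case: xgetP.
  move=> u _ [_ /circ_inj[k ->]].
  by rewrite mulrDr -[d%:R * k%:~R]/(d%:Z%:~R * k%:~R) -intrM circDz.
move=> /(_ (t - (Num.floor t)%:~R)) []; split; last by rewrite -mulrNz circDz.
have := Num.Theory.floor_le t; have := floorD1_gt t.
by rewrite intrD => h1 h2; apply/andP; split; lra.
Qed.

End Circle.

Section Lamination.
Variables (R : realType) (d : nat).
Implicit Types (L : set (plane R * plane R)) (G : set (plane R)).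

(* A lamination is a set of pairs (a, b), each one standing for the chord from
   a to b; the points of the circle are the degenerate chords (a, a). *)
Definition lamination L : Prop :=
  [/\ forall a b, L (a, b) -> unit_circle a /\ unit_circle b,
      forall a b, L (a, b) -> L (b, a),
      forall a, unit_circle a -> L (a, a),
      closed L
    & forall a b a' b', L (a, b) -> L (a', b') ->
        [\/ (a', b') = (a, b), (a', b') = (b, a)
          | chord a b `&` chord a' b' `<=` [set a; b] `&` [set a'; b']]].

Definition support L : set (plane R) :=
  [set x | exists a b, L (a, b) /\ chord a b x].

Definition round_gap L G : Prop :=
  (exists2 x, (unit_disk `\` support L) x
     & G = closure (connected_component (unit_disk `\` support L) x)) /\
  (exists s t : R, s < t /\ @circ R @` `[s, t] `<=` boundary G).

(* sigma d extended affinely over the chords of L. *)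
Definition sigma_ext L (x : plane R) : plane R :=
  xget x [set y | exists a b t, [/\ L (a, b), 0 <= t <= 1,
    x = (1 - t) *: a + t *: b
  & y = (1 - t) *: sigma d a + t *: sigma d b]].

Lemma sigma_ext_chord L a b (t : R) : lamination L -> L (a, b) -> 0 <= t <= 1 ->
  sigma_ext L ((1 - t) *: a + t *: b) =
  (1 - t) *: sigma d a + t *: sigma d b.
Proof.
move=> [_ _ _ _ cross] Lab t01; rewrite /sigma_ext.
have aff (p q : plane R) (u v : R) : (1 - u) *: p + u *: q =
    (1 - v) *: p + v *: q -> u = v \/ p = q.
  move=> e; have : (u - v) *: (q - p) = 0.
    rewrite -[RHS](subrr ((1 - v) *: p + v *: q)) -{1}e.
    rewrite [LHS]surjective_pairing [RHS]surjective_pairing /= /GRing.scale /=.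
    by congr (_, _); ring.
  by move=> /eqP; rewrite scaler_eq0 !subr_eq0 => /orP[]/eqP; auto.
have affx (p : plane R) (u : R) : (1 - u) *: p + u *: p = p.
  by rewrite -scalerDl subrK scale1r.
have endp (p q x : plane R) (u : R) : x = (1 - u) *: p + u *: q ->
    x = p \/ x = q ->
    (1 - u) *: sigma d p + u *: sigma d q = sigma d x.
  move=> -> [] e.
    have [u0|<-] : u = 0 \/ p = q by apply: aff; rewrite e subr0 scale1r scale0r addr0.
      by rewrite u0 subr0 !scale1r !scale0r !addr0.
    by rewrite !affx.
  have [u0|<-] : u = 1 \/ p = q by apply: aff; rewrite e subrr scale1r scale0r add0r.
    by rewrite u0 subrr !scale1r !scale0r !add0r.
  by rewrite !affx.
set x := _ + _; case: xgetP; last first.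
  move=> /(_ ((1 - t) *: sigma d a + t *: sigma d b)) [].
  by exists a, b, t.
move=> _ _ [a' [b' [t' [La'b' t'01 xE ->]]]].
have [[ea eb]|[ea eb]|] := cross _ _ _ _ Lab La'b'.
- by move: xE; rewrite ea eb => /aff[-> //|->]; rewrite !affx.
- rewrite ea eb in xE *.
  have /aff[->|->] : (1 - t) *: a + t *: b = (1 - (1 - t')) *: a + (1 - t') *: b.
    by rewrite -/x xE subKr addrC.
    by rewrite subKr addrC.
  by rewrite !affx.
- have xab : chord a b x by exists t.
  have xab' : chord a' b' x by exists t'.
  move=> /(_ x (conj xab xab')) [xe xe'].
  by rewrite (endp _ _ _ _ xE xe') (endp _ _ x t erefl xe).
Qed.

Definition gap_degree L G (i : nat) : Prop :=
  let f := sigma_ext L in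
  covering_map i f (boundary G) (f @` boundary G) /\
  positively_oriented f (boundary G) (f @` boundary G).

Definition gap_image L G : set (plane R) :=
  filled (sigma_ext L @` boundary G).

End Lamination.

(* A polygon is represented by its set of vertices. *)
Notation polygon R := {fset plane R}.

Section Portraits.
Local Open Scope fset_scope.
Variables (R : realType) (d : nat).
Implicit Types (P Q : polygon R) (G : set (plane R)).

Definition ngon (n : nat) P : Prop :=
  [/\ ([set` P] `<=` unit_circle)%classic, (2 <= n)%N & #|` P| = n].

Definition polygon_region P : set (plane R) := convex_hull [set` P].

(* (a, b) is a side of P directed so that P lies on its left; a 2-gon {a, b}
   has the two sides (a, b) and (b, a). *)
Definition is_side P (e : plane R * plane R) : bool :=
  [&& e.1 \in P, e.2 \in P, e.1 != e.2
    & all [pred c | (c == e.1) || (c == e.2) || (0 < orient e.1 e.2 c)] P].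

Definition sides P : {fset plane R * plane R} :=
  [fset e in P `*` P | is_side P e].

Definition polygon_image Q : polygon R := [fset sigma d x | x in Q].

Definition sides_over Q (e : plane R * plane R) : {fset plane R * plane R} :=
  [fset s in sides Q | (sigma d s.1, sigma d s.2) == e].

Definition sibling_portrait G (i : nat) P (S : {fset polygon R}) : Prop :=
  [/\ forall Q, Q \in S ->
        [/\ exists m, ngon m Q, (polygon_region Q `<=` G)%classic
          & polygon_image Q = P],
      forall Q Q', Q \in S -> Q' \in S -> Q != Q' ->
        (polygon_region Q `&` polygon_region Q' = set0)%classic
    & forall e, e \in sides P -> (\sum_(Q <- S) #|` sides_over Q e| = i)%N].

Definition one_to_one_portrait G (i : nat) P (S : {fset polygon R}) : Prop :=
  sibling_portrait G i P S /\
  (forall Q, Q \in S -> {in Q &, injective (sigma d)}).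

End Portraits.

(* Main.v *)
Require Import Defs.
From HB Require Import structures.
From mathcomp Require Import all_boot zify.

(** Both numbers count lattice words with [i] up-steps of height [n] and [i * n]
    down-steps of height 1.

    Let [R] be the gap. The map is increasing of degree [i] in counterclockwise
    parameters, so the points of the boundary of [R] that map to vertices of [P]
    form [i] successive copies of the cyclic sequence of these vertices: a
    cyclic list of [i * n] points, the j-th of which lies over the vertex number
    [j mod n] ([polygon_enumeration]). All of them lie on the circle. Otherwise
    one would be interior to a leaf whose two endpoints have the same image;
    that leaf would lie in the boundary of [R] and be collapsed to a point,
    whereas a covering map of degree [i] has fibers with [i] points
    ([leaf_boundary], [preimage_on_circle]). As [R] is convex, the
    polygons of a portrait are the convex hulls of arbitrary subsets of the
    list, and two hulls are disjoint exactly when the subsets are disjoint and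
    do not cross ([disjoint_regionsP]).

    A point of the list is the start of at most one side of the portrait, and
    only [i] points lie over a given vertex. Having [i] sides over each side of
    [P] therefore forces every point to be used and every side to join a point
    labelled [k] to one labelled [k + 1]. It follows that sibling portraits are
    the noncrossing partitions of [i * n] points whose block sizes are divisible
    by [n] ([cyclic_portrait_dvdn]); conversely, in such a partition the points
    between two successive points of a block form a union of blocks, which makes
    the labels advance by one ([next_in_mod]). A polygon maps one-to-one when
    its size is exactly [n].

    A noncrossing partition is determined by the word that gives at the first
    point of each block the size of this block, and 0 at every other point; the
    words that occur are the Lukasiewicz words ([opening_inj],
    [opening_surj]). So [F(i, n)] counts the Lukasiewicz words of length
    [i * n] with letters divisible by [n], and [f(i, n + 1)] those of length
    [i * (n + 1)] with letters 0 and [n + 1]. Reading a letter [n * j] as [j]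
    up-steps followed by a down-step in the first case, and the letters [n + 1]
    and 0 as an up-step and a down-step in the second case, identifies both with
    the same lattice words ([card_lukasiewicz_dvd],
    [card_lukasiewicz_eq]). *)

Set Implicit Arguments.
Unset Strict Implicit.
Unset Printing Implicit Defensive.

(** * Lukasiewicz words and lattice words *)

Section Words.
Local Open Scope nat_scope.

(** The word [s] read as a path that starts at height [h]: a letter [a] moves by
    [a - 1], the path stays nonnegative and ends at 0. *)
Fixpoint lukasiewicz (h : nat) (s : seq nat) : bool :=
  if s is a :: s' then (0 < h + a) && lukasiewicz (h + a).-1 s' else h == 0.

(** The same condition for paths with up-steps [n] and down-steps 1. *)
Fixpoint dyck (n h : nat) (w : bitseq) : bool :=
  match w with
  | [::] => h == 0
  | true :: w' => dyck n (h + n) w'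
  | false :: w' => (0 < h) && dyck n h.-1 w'
  end.

Lemma lukasiewiczP h s :
  reflect ((forall k, k <= size s -> k <= h + sumn (take k s)) /\
           size s = h + sumn s)
          (lukasiewicz h s).
Proof.
elim: s h => [|a s IH] h /=.
  by apply: (iffP eqP) => [->|[_]]; [split=> // k; rewrite leqn0 => /eqP -> | lia].
apply: (iffP andP) => [[ha /IH[bal tot]]|[bal tot]].
  by split=> [[|k] // /bal|] /=; lia.
have /= := bal 1 isT; rewrite take0 /= => ha; split; first by lia.
apply/IH; split=> [k ks|]; last by lia.
by have /= := bal k.+1 ks; lia.
Qed.

Lemma dyck_count n h w : dyck n h w ->
  count negb w = h + n * count id w.
Proof.
elim: w h => [|[] w IH] h /=; first by move/eqP->; lia.
  by move/IH; lia.
by case/andP=> h0 /IH; lia.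
Qed.

(** The down-step that closes a run of up-steps is the [- 1] in the move [a - 1] of
    the letter [a] that the run stands for. *)
Definition ups_word (s : seq nat) : bitseq :=
  flatten [seq rcons (nseq j true) false | j <- s].

Lemma ups_word_inj : injective ups_word.
Proof.
elim=> [|j s IH] [|j' s'] //=; rewrite /ups_word /= -/(ups_word _).
- by case: j'.
- by case: j.
have cat_eq (u u' : bitseq) : rcons (nseq j true) false ++ u =
    rcons (nseq j' true) false ++ u' -> j = j' /\ u = u'.
  elim: j j' {IH} => [|j IHj] [|j'] //= [] //.
  by move=> /IHj[-> ->].
by case/cat_eq=> -> /IH ->.
Qed.

Lemma dyck_ups_word n h s :
  dyck n h (ups_word s) = lukasiewicz h [seq n * j | j <- s].
Proof.
elim: s h => [|j s IH] h //; rewrite /ups_word /= -/(ups_word _) -cats1 -catA.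
elim: j h => [|j IHj] h /=; first by rewrite muln0 addn0 IH.
by rewrite IHj mulnS addnA.
Qed.

Lemma ups_word_count s :
  count negb (ups_word s) = size s /\ count id (ups_word s) = sumn s.
Proof.
elim: s => [|j s [IH1 IH2]] //; rewrite /ups_word /= -/(ups_word _).
by rewrite !count_cat IH1 IH2 -cats1 !count_cat !count_nseq /=; lia.
Qed.

Lemma ups_word_surj w : last false w = false -> exists s, ups_word s = w.
Proof.
elim: w => [|b w IH] lw; first by exists [::].
case: b lw => /= lw.
  case: w IH lw => [|c w] //= /[apply] -[[|j s]] //=.
  rewrite /ups_word /= => <-; exists (j.+1 :: s) => //.
have [|s <-] := IH; first by case: w {IH} lw.
by exists (0 :: s).
Qed.

(** The path ends at height 0, and an up-step ends at a positive height. *)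
Lemma dyck_last n h w : 0 < n -> dyck n h w -> last false w = false.
Proof.
move=> n0; suff : forall b : bool, (b -> 0 < h) -> dyck n h w -> last b w = false by apply.
elim: w h => [|c w IH] h b hb /=.
  by move=> /eqP h0; apply/negbTE/negP => /hb; rewrite h0.
case: c => [|/andP[_]]; last exact: IH.
by apply: IH; lia.
Qed.

End Words.

(** * Noncrossing partitions *)

Section Noncrossing.
Local Open Scope nat_scope.
Local Open Scope set_scope.
Variable N : nat.
Implicit Types (A B D Q U : {set 'I_N}) (P S : {set {set 'I_N}}) (x y z : 'I_N).

(** The four points alternate in the linear order of ['I_N]; letting [A] and [B]
    exchange roles covers both alternations, hence the cyclic notion. *)
Definition noncrossing S : Prop :=
  forall A B, A \in S -> B \in S -> forall a b c d : 'I_N,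
    a \in A -> b \in B -> c \in A -> d \in B -> a < b -> b < c -> c < d ->
    A = B.

Definition is_min B x : bool := (x \in B) && [forall y in B, x <= y].

Definition opening P x : nat := \sum_(B in P | is_min B x) #|B|.

Lemma is_minP B x :
  reflect (x \in B /\ forall y, y \in B -> x <= y) (is_min B x).
Proof.
by apply: (iffP andP) => -[xB] => [/forall_inP|h]; split=> //; apply/forall_inP.
Qed.

Lemma is_min_uniq B x y : is_min B x -> is_min B y -> x = y.
Proof.
move=> /is_minP[xB xm] /is_minP[yB ym]; apply/val_inj/eqP.
by rewrite eqn_leq xm // ym.
Qed.

Lemma ex_is_min B : B != set0 -> exists x, is_min B x.
Proof.
case/set0Pn=> x0 x0B; case: (arg_minnP (fun x : 'I_N => val x) x0B) => x xB xm.
by exists x; apply/is_minP.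
Qed.

Section Partition.
Variables (P : {set {set 'I_N}}) (D : {set 'I_N}).
Hypothesis PD : partition P D.

Lemma partition_disj A B x : A \in P -> B \in P -> x \in A -> x \in B -> A = B.
Proof.
have /and3P[_ /trivIsetP tI _] := PD.
move=> AP BP xA xB; apply/eqP/negPn/negP => /(tI _ _ AP BP).
by move/disjoint_setI0/setP/(_ x); rewrite !inE xA xB.
Qed.

Lemma partition_in B x : B \in P -> x \in B -> x \in D.
Proof.
have /and3P[/eqP <- _ _] := PD; move=> BP xB; exact/bigcupP/(ex_intro2 _ _ B).
Qed.

Lemma partition_ex x : x \in D -> exists2 B, B \in P & x \in B.
Proof. by have /and3P[/eqP <- _ _] := PD => /bigcupP[B]; exists B. Qed.

Lemma partition_neq0 B : B \in P -> B != set0.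
Proof.
by have /and3P[_ _ P0] := PD; move=> BP; apply: contraNneq P0 => <-.
Qed.

Lemma openingE B x : B \in P -> is_min B x -> opening P x = #|B|.
Proof.
move=> BP Bx; rewrite /opening (big_pred1 B) // => A /=.
apply/andP/eqP => [[AP Ax]|->] //.
by apply: (@partition_disj _ _ x) => //; [case/is_minP: Ax|case/is_minP: Bx].
Qed.

Lemma opening_gt0 B x : B \in P -> is_min B x -> 0 < opening P x.
Proof. by move=> BP Bx; rewrite (openingE BP Bx) card_gt0 partition_neq0. Qed.

Lemma opening_block x : 0 < opening P x -> exists2 B, B \in P & is_min B x.
Proof.
rewrite lt0n sum_nat_eq0 => /forallPn[B].
by rewrite negb_imply => /andP[/andP[BP Bx] _]; exists B.
Qed.

(** The block that opens last contains every later point up to its end: the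
    block of such a point opens earlier, so it would cross the last one. *)
Lemma last_block B x : noncrossing P -> B \in P -> is_min B x ->
  (forall y, y \in D -> x < y -> opening P y = 0) ->
  forall z w, z \in D -> x <= z -> w \in B -> z <= w -> z \in B.
Proof.
move=> nc BP Bx xlast z w zD xz wB zw.
have [B' B'P zB'] := partition_ex zD.
have [m B'm] := ex_is_min (partition_neq0 B'P).
have /is_minP[mB' mmin] := B'm; have /is_minP[xB xmin] := Bx.
have mx : m <= x.
  rewrite leqNgt; apply/negP => /xlast.
  by move=> /(_ (partition_in B'P mB')) e; have := opening_gt0 B'P B'm; rewrite e.
have [<-//|nB] := eqVneq B' B.
have neq u v : u \in B' -> v \in B -> u != v :> nat.
  move=> uB' vB; apply: contra nB => /eqP/val_inj uv.
  by apply/eqP/(partition_disj B'P BP uB'); rewrite uv.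
suff e : B' = B by rewrite e eqxx in nB.
apply: (nc _ _ B'P BP m x z w) => //.
- by rewrite ltn_neqAle neq.
- by rewrite ltn_neqAle xz andbT eq_sym neq.
- by rewrite ltn_neqAle zw andbT neq.
Qed.

Lemma partition_remove B : B \in P -> partition (P :\ B) (D :\: B).
Proof.
move=> BP; have /and3P[/eqP cP tI P0] := PD; apply/and3P; split.
- apply/eqP/setP=> x; rewrite in_setD; apply/bigcupP/andP => [[A]|[xB xD]].
    rewrite in_setD1 => /andP[AB AP] xA; split; last exact: partition_in xA.
    by apply: contra AB => xB; apply/eqP/(partition_disj AP BP xA).
  have [A AP xA] := partition_ex xD; exists A => //.
  by rewrite in_setD1 AP andbT; apply: contraNneq xB => <-.
- by apply: trivIsetS tI; apply: subD1set.
- by rewrite in_setD1 (negPf P0) andbF.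
Qed.

Lemma opening_remove B x : B \in P -> x \notin B ->
  opening (P :\ B) x = opening P x.
Proof.
move=> BP xB; rewrite /opening; apply: eq_bigl => A; rewrite in_setD1.
have [->|//] := eqVneq A B; rewrite BP /=.
by apply/esym/negbTE; apply: contra xB => /is_minP[].
Qed.

End Partition.

Lemma noncrossingS P P' : P' \subset P -> noncrossing P -> noncrossing P'.
Proof. by move=> /subsetP s nc A B /s AP /s BP; apply: nc. Qed.

(** Initial segments of a linear order are nested. *)
Lemma initial_segment_uniq U B B' : B \subset U -> B' \subset U ->
  #|B| = #|B'| ->
  (forall z w, z \in U -> w \in B -> z <= w -> z \in B) ->
  (forall z w, z \in U -> w \in B' -> z <= w -> z \in B') -> B = B'.
Proof.
move=> /subsetP BU /subsetP B'U cB Bd B'd.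
suff : (B \subset B') || (B' \subset B).
  case/orP=> s; first by apply/eqP; rewrite eqEcard s cB leqnn.
  by apply/eqP; rewrite eq_sym eqEcard s cB leqnn.
have [//|/subsetPn[w wB wB']] := boolP (B \subset B'); apply/subsetP=> v vB'.
apply: (Bd _ w) => //; first exact: B'U.
rewrite leqNgt; apply/negP => /ltnW wv; move/negP: wB'; apply.
by apply: (B'd _ _ _ vB' wv); apply: BU.
Qed.

Lemma initial_segment_ex U s : s <= #|U| -> exists B, [/\ B \subset U, #|B| = s
  & forall z w, z \in U -> w \in B -> z <= w -> z \in B].
Proof.
elim: s => [|s IH] sU.
  by exists set0; rewrite sub0set cards0; split=> // z w; rewrite !inE.
have [|B [BU cB Bd]] := IH; first exact: ltnW.
have /ex_is_min[m /is_minP[]] : U :\: B != set0.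
  by rewrite -card_gt0 cardsD (setIidPr BU) cB subn_gt0.
rewrite in_setD => /andP[mB mU] mm; exists (m |: B).
rewrite subUset sub1set mU BU cardsU1 mB cB add1n; split=> // z w zU.
rewrite !in_setU1 => /orP[/eqP->|wB] zw; last first.
  by rewrite (Bd z w) ?orbT.
have [//|zB] := boolP (z \in B); first by rewrite orbT.
rewrite orbF; apply/eqP/val_inj/eqP; rewrite eqn_leq zw mm //.
by rewrite in_setD zB.
Qed.

Lemma last_pos (D : {set 'I_N}) (a : 'I_N -> nat) x0 : x0 \in D -> 0 < a x0 ->
  exists x, [/\ x \in D, 0 < a x & forall y, y \in D -> x < y -> a y = 0].
Proof.
move=> x0D ax0; have h0 : (x0 \in D) && (0 < a x0) by rewrite x0D.
case: (@arg_maxnP _ x0 (fun y => (y \in D) && (0 < a y)) (fun y : 'I_N => val y) h0).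
move=> x /andP[xD ax] xm; exists x; split=> // y yD xy.
apply/eqP; rewrite -leqn0 leqNgt; apply/negP => ay.
by have /= := xm y; rewrite yD ay leqNgt xy => /(_ isT).
Qed.

(** The block that opens last is an initial segment of what follows its
    opening, and its size can be read off; removing it leaves a noncrossing
    partition of fewer points. Partitions of arbitrary subsets [D] are considered
    so that this removal needs no renumbering. *)
Lemma opening_inj D P P' : partition P D -> partition P' D ->
  noncrossing P -> noncrossing P' -> {in D, opening P =1 opening P'} -> P = P'.
Proof.
have [k] := ubnP #|D|; elim: k D P P' => // k IH D P P' Dk PD PD' nc nc' eo.
have [D0|/set0Pn[x0 x0D]] := eqVneq D set0.
  by move: PD PD'; rewrite D0 !partition_set0 => /eqP-> /eqP->.
have [B0 B0P x0B0] := partition_ex PD x0D.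
have [m B0m] := ex_is_min (partition_neq0 PD B0P).
have mD : m \in D by apply: (partition_in PD B0P); case/is_minP: B0m.
have [x [xD ox xlast]] := last_pos mD (opening_gt0 PD B0P B0m).
have [B BP Bx] := opening_block ox.
have [B' B'P' B'x] : exists2 B, B \in P' & is_min B x.
  by apply: opening_block; rewrite -eo.
pose U := [set z in D | x <= z].
have sub Q (Q' : {set {set 'I_N}}) : partition Q' D -> Q \in Q' -> is_min Q x -> Q \subset U.
  move=> Q'D QQ' /is_minP[xQ Qx]; apply/subsetP => y yQ.
  by rewrite inE (partition_in Q'D QQ') ?Qx.
have eB : B = B'.
  apply: (@initial_segment_uniq U); rewrite ?(sub _ _ PD BP Bx) ?(sub _ _ PD' B'P' B'x) //.
  - by rewrite -(openingE PD BP Bx) -(openingE PD' B'P' B'x) eo.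
  - move=> z w; rewrite inE => /andP[zD xz] wB zw.
    exact: (last_block PD nc BP Bx xlast zD xz wB zw).
  - move=> z w; rewrite inE => /andP[zD xz] wB zw.
    apply: (last_block PD' nc' B'P' B'x _ zD xz wB zw) => y yD xy.
    by rewrite -eo // xlast.
rewrite -{}eB in B'P' B'x.
have -> : P = B |: (P :\ B) by rewrite setD1K.
have -> : P' = B |: (P' :\ B) by rewrite setD1K.
congr (_ |: _); apply: (IH (D :\: B)).
- apply: leq_trans (_ : #|D| <= _) => //; apply: proper_card.
  apply/properP; split; first exact: subsetDl.
  by exists x => //; rewrite in_setD; case/is_minP: Bx => ->.
- exact: partition_remove.
- exact: partition_remove.
- by apply: noncrossingS nc; apply: subD1set.
- by apply: noncrossingS nc'; apply: subD1set.
- by move=> y; rewrite in_setD => /andP[yB yD];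
    rewrite (opening_remove BP) // (opening_remove B'P') // eo.
Qed.

(** The same removal, run backwards: the ballot condition guarantees that enough
    points follow the last opening to form its block, and an initial segment
    of these points crosses no other block. *)
Lemma opening_surj D (a : 'I_N -> nat) :
  (forall k, #|[set x in D | x < k]| <= \sum_(x in D | x < k) a x) ->
  #|D| = \sum_(x in D) a x ->
  exists P, [/\ partition P D, noncrossing P & {in D, opening P =1 a}].
Proof.
have [k] := ubnP #|D|; elim: k D => // k IH D Dk bal tot.
have [D0|nD] := eqVneq D set0.
  exists set0; rewrite D0 partition_set0 eqxx; split=> [//|A B|A]; by rewrite in_set0.
have [x0 x0D ax0] : exists2 x0, x0 \in D & 0 < a x0.
  move: nD; rewrite -card_gt0 tot lt0n sum_nat_eq0 => /forallPn[x0].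
  by rewrite negb_imply -lt0n => /andP[]; exists x0.
have [x [xD ax xlast]] := last_pos x0D ax0.
pose U := [set z in D | x <= z].
have cardU j : #|D| = #|[set z in D | z < j]| + #|[set z in D | j <= z]|.
  rewrite -(cardsID [set z : 'I_N | z < j] D); congr (_ + _).
    by apply: eq_card => z; rewrite !inE.
  by apply: eq_card => z; rewrite !inE -leqNgt andbC.
have sumU j : x < j -> \sum_(z in D | z < j) a z = #|D|.
  move=> xj; rewrite tot big_mkcondr /=; apply: eq_bigr => z zD.
  case: ltnP => // jz; rewrite xlast //; lia.
have sumUx : \sum_(z in D | z < x) a z + a x = #|D|.
  rewrite -(sumU x.+1) // [in RHS](bigD1 x) ?xD ?ltnSn //= addnC; congr addn.
  apply: eq_bigl => z; rewrite ltnS -andbA; congr (_ && _).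
  by rewrite ltn_neqAle andbC.
have [|B [BU cB Bd]] := @initial_segment_ex U (a x).
  by have := bal x; have := cardU x; rewrite -/U; lia.
have /set0Pn[w wB] : B != set0 by rewrite -card_gt0 cB.
have BUP y : y \in B -> y \in D /\ x <= y.
  by move/(subsetP BU); rewrite inE => /andP[].
have xB : x \in B.
  by apply: (Bd _ _ _ wB); rewrite ?inE ?xD ?leqnn //; case: (BUP w wB).
have Bx : is_min B x by apply/is_minP; split=> // y /BUP[].
have BD : B \subset D by apply/subsetP => y /BUP[].
have cD : #|D :\: B| + a x = #|D| by rewrite -(cardsID B D) (setIidPr BD) cB addnC.
have sumD j : \sum_(z in D :\: B | z < j) a z + (x < j) * a x
    = \sum_(z in D | z < j) a z.
  rewrite [in RHS](bigID (mem B)) /= addnC; congr (_ + _); last first.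
    by apply: eq_bigl => z; rewrite !inE; case: (z \in B); rewrite ?andbF ?andbT.
  case: (ltnP x j) => xj; last first.
    rewrite big1 // => z /andP[/andP[_ zj] zB].
    have [_ xz] := BUP z zB; lia.
  rewrite (bigD1 x) ?xD ?xj ?xB //= big1 ?addn0 ?mul1n // => z /andP[/andP[/andP[_ _] zB] zx].
  have [zD xz] := BUP z zB; apply: xlast => //.
  by rewrite ltn_neqAle xz andbT eq_sym.
have [||| P' [PD' nc' oP']] := IH (D :\: B).
- have := cD; lia.
- move=> j; case: (ltnP x j) => xj.
    have := sumD j; rewrite xj [true : nat]/= mul1n sumU // => e.
    apply: (@leq_trans #|D :\: B|); last lia.
    by apply/subset_leq_card/subsetP => z; rewrite inE => /andP[].
  have := sumD j; rewrite ltnNge xj [~~ true : nat]/= mul0n addn0 => ->.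
  apply: leq_trans (bal j); apply/subset_leq_card/subsetP => z.
  by rewrite !inE => /andP[/andP[_ ->] ->].
- have := sumD N; rewrite sumU // ltn_ord [true : nat]/= mul1n -cD => /eqP; rewrite eqn_add2r => /eqP <-.
  by apply: eq_bigl => z; rewrite ltn_ord andbT.
have BP' : B \notin P'.
  apply/negP => /(partition_in PD') /(_ xB); by rewrite in_setD xB.
have PD : partition (B |: P') D.
  have -> : D = B :|: (D :\: B).
    by apply/setP => z; rewrite in_setU in_setD; case: (boolP (z \in B)) => //= /BUP[].
  apply: partitionU1 => //.
  - by apply/set0Pn; exists w.
  - by rewrite -setI_eq0; apply/eqP/setP=> z; rewrite !inE; case: (z \in B).
exists (B |: P'); split=> //.
  have ninB A : A \in P' -> forall z, z \in A -> (z \in D) && (z \notin B).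
    by move=> AP z zA; have := partition_in PD' AP zA; rewrite in_setD andbC.
  move=> A A'; rewrite !in_setU1 => /orP[/eqP->|AP] /orP[/eqP->|A'P] // p q r s.
  - move=> pB qA' rB sA' pq qr rs.
    have /andP[qD /negP[]] := ninB _ A'P q qA'.
    apply: (Bd _ _ _ rB (ltnW qr)); rewrite inE qD.
    by have [_ xp] := BUP p pB; apply: leq_trans xp (ltnW pq).
  - move=> pA qB rA sB pq qr rs.
    have /andP[rD /negP[]] := ninB _ AP r rA.
    apply: (Bd _ _ _ sB (ltnW rs)); rewrite inE rD.
    by have [_ xq] := BUP q qB; apply: leq_trans xq (ltnW qr).
  - exact: nc'.
move=> y yD; have [yB|yB] := boolP (y \in B).
  have [->|yx] := eqVneq y x.
    by rewrite (openingE PD _ Bx) ?setU11.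
  have xy : x < y by rewrite ltn_neqAle eq_sym yx; case: (BUP y yB).
  rewrite (xlast y yD xy); apply/eqP; rewrite -leqn0 leqNgt; apply/negP.
  move=> /(opening_block)[A AP Ay].
  have AB : A = B.
    by apply: (partition_disj PD AP (setU11 _ _) _ yB); case/is_minP: Ay.
  move: Ay yx; rewrite AB => By; by rewrite (is_min_uniq By Bx) eqxx.
rewrite -oP'; last by rewrite in_setD yB.
by rewrite -(@opening_remove (B |: P') B) ?setU11 // setU1K.
Qed.


Lemma card_ord_lt k : k <= N -> #|[pred x : 'I_N | x < k]| = k.
Proof.
move=> kN; rewrite -sum1_card.
rewrite -(big_ord_widen_cond N predT (fun=> 1) kN) /=.
by rewrite sum1_card card_ord.
Qed.

(** Each of the first [k] points lies in a block that opens among them. *)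
Lemma leq_sum_opening P k : partition P [set: 'I_N] -> k <= N ->
  k <= \sum_(x : 'I_N | x < k) opening P x.
Proof.
move=> PD kN; rewrite (exchange_big_dep (mem P)) /=; last by move=> x B _ /andP[].
apply: (@leq_trans (\sum_(B in P) \sum_(x in B | x < k) 1)).
  rewrite -(set_partition_big_cond P PD) -{1}(card_ord_lt kN) -sum1_card.
  by apply/eq_leq/eq_bigl => x; rewrite in_setT inE.
apply: leq_sum => B BP; have [m Bm] := ex_is_min (partition_neq0 PD BP).
have /is_minP[mB mmin] := Bm; have [mk|km] := ltnP m k; last first.
  by rewrite big1 // => x /andP[/mmin mx xk]; lia.
rewrite sum1_card (bigD1 m) /= ?mk ?BP ?Bm //; apply: leq_trans (leq_addr _ _).
by apply/subset_leq_card/subsetP => x /andP[].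
Qed.

Lemma sum_opening P : partition P [set: 'I_N] -> \sum_x opening P x = N.
Proof.
move=> PD; rewrite -[RHS]card_ord -[in RHS]cardsT (card_partition PD).
rewrite /opening (exchange_big_dep (mem P)) /=; last by move=> ? ? _ /andP[].
apply: eq_bigr => B BP.
have [m Bm] := ex_is_min (partition_neq0 PD BP).
rewrite (big_pred1 m) // => x; apply/andP/eqP => [[_ /is_min_uniq]|->] //.
by apply.
Qed.

Definition opening_word P : seq nat := [seq opening P x | x <- enum 'I_N].

Lemma size_opening_word P : size (opening_word P) = N.
Proof. by rewrite size_map size_enum_ord. Qed.

Lemma nth_opening_word P x : nth 0 (opening_word P) x = opening P x.
Proof. by rewrite (nth_map x) ?size_enum_ord // nth_ord_enum. Qed.

Lemma sumn_take (s : seq nat) k : size s = N -> k <= N ->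
  sumn (take k s) = \sum_(x : 'I_N | x < k) nth 0 s x.
Proof.
move=> sN kN; rewrite sumnE (big_nth 0) size_take sN.
have -> : (if k < N then k else N) = k by case: ltngtP kN.
rewrite big_mkord (big_ord_widen_cond N predT) //=.
by apply: eq_bigr => x xk; rewrite nth_take.
Qed.

Lemma lukasiewicz_opening_word P : partition P [set: 'I_N] ->
  lukasiewicz 0 (opening_word P).
Proof.
move=> PD; apply/lukasiewiczP; rewrite size_opening_word add0n; split=> [k kN|].
  rewrite add0n sumn_take ?size_opening_word //.
  under eq_bigr do rewrite nth_opening_word; exact: leq_sum_opening.
rewrite -{1}(sum_opening PD) -[in RHS](take_size (opening_word P)) size_opening_word.
rewrite sumn_take ?size_opening_word //; apply: eq_big => x; first by rewrite ltn_ord.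
by rewrite nth_opening_word.
Qed.

Lemma opening_word_inj P P' :
  partition P [set: 'I_N] -> partition P' [set: 'I_N] ->
  noncrossing P -> noncrossing P' -> opening_word P = opening_word P' -> P = P'.
Proof.
move=> PD PD' nc nc' e; apply: (opening_inj PD PD' nc nc') => x _.
by rewrite -!nth_opening_word e.
Qed.

Lemma opening_word_surj s : size s = N -> lukasiewicz 0 s ->
  exists P, [/\ partition P [set: 'I_N], noncrossing P & opening_word P = s].
Proof.
move=> sN /lukasiewiczP[bal tot].
have takeN : take N s = s by rewrite -sN take_size.
have sumN : N = \sum_(x : 'I_N | x < N) nth 0 s x.
  by rewrite -sumn_take // takeN; lia.
have [k||P [PD nc oP]] := @opening_surj [set: 'I_N] (fun x => nth 0 s x).
- have [kN|/ltnW Nk] := leqP k N.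
    have := bal k; rewrite sN add0n sumn_take // => /(_ kN).
    under [X in _ -> _ <= X]eq_bigl do rewrite in_setT.
    apply: leq_trans; rewrite -{2}(card_ord_lt kN).
    by apply/subset_leq_card/subsetP => x; rewrite !inE.
  apply: (@leq_trans N); first by rewrite -[X in _ <= X]card_ord max_card.
  rewrite {1}sumN; apply/eq_leq/eq_bigl => x; rewrite in_setT !ltn_ord.
  by rewrite (leq_trans (ltn_ord x)).
- rewrite cardsT card_ord {1}sumN.
  by apply: eq_bigl => x; rewrite in_setT ltn_ord.
exists P; split=> //; apply: (@eq_from_nth _ 0); first by rewrite size_opening_word.
move=> j; rewrite size_opening_word => jN.
by rewrite (nth_opening_word P (Ordinal jN)) oP ?in_setT.
Qed.

Lemma all_opening_word (p : pred nat) P : partition P [set: 'I_N] -> p 0 ->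
  all p (opening_word P) = [forall B in P, p #|B|].
Proof.
move=> PD p0; apply/allP/forall_inP => [h B BP|h _ /mapP[x _ ->]].
  have [m Bm] := ex_is_min (partition_neq0 PD BP).
  rewrite -(openingE PD BP Bm) -nth_opening_word h // mem_nth //.
  by rewrite size_opening_word.
have [->//|] := posnP (opening P x).
by case/opening_block => B BP Bx; rewrite (openingE PD BP Bx) h.
Qed.

End Noncrossing.

(** * Portraits on a cyclically labelled list of points *)

Section CyclicSides.
Local Open Scope nat_scope.

Definition cyclic (a b c : nat) : bool :=
  [|| a < b < c, b < c < a | c < a < b].

Variable N : nat.
Implicit Types (A B Q : {set 'I_N}) (P S : {set {set 'I_N}}) (a b x y : 'I_N).

(** The point [b] is the first point of [Q] met after [a] when going around. *)
Definition next_in Q a b : bool :=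
  [&& a \in Q, b \in Q, a != b
    & [forall c in Q, [|| c == a, c == b | cyclic a b c]]].

Lemma next_inP Q a b :
  reflect [/\ a \in Q, b \in Q, a != b :> nat
    & forall c, c \in Q -> [|| c == a :> nat, c == b :> nat | cyclic a b c]]
    (next_in Q a b).
Proof. by apply: (iffP and4P) => -[aQ bQ ab] => [/forall_inP|h]; split=> //; apply/forall_inP. Qed.

Lemma next_in_uniq Q a b b' : next_in Q a b -> next_in Q a b' -> b = b'.
Proof.
move=> /next_inP[_ bQ ab h] /next_inP[_ b'Q ab' h']; apply/val_inj => /=.
by have := h _ b'Q; have := h' _ bQ; rewrite /cyclic; lia.
Qed.

Lemma next_in_inj Q a a' b : next_in Q a b -> next_in Q a' b -> a = a'.
Proof.
move=> /next_inP[aQ _ ab h] /next_inP[a'Q _ ab' h']; apply/val_inj => /=.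
by have := h _ a'Q; have := h' _ aQ; rewrite /cyclic; lia.
Qed.

Lemma next_in_ex Q a : 1 < #|Q| -> a \in Q -> exists b, next_in Q a b.
Proof.
move=> Q1 aQ; have [E0|/ex_is_min[b /is_minP[]]] := eqVneq [set c in Q | a < c] set0.
  have /ex_is_min[b /is_minP[]] : Q :\ a != set0.
    by rewrite -card_gt0; move: Q1; rewrite (cardsD1 a) aQ.
  rewrite in_setD1 => /andP[ba bQ] bmin; exists b; apply/next_inP; split=> //.
    by rewrite eq_sym.
  move=> c cQ; have [->|ca] := eqVneq c a; first by rewrite eqxx.
  have := bmin c; rewrite in_setD1 ca cQ => /(_ isT) bc.
  have /setP/(_ c) := E0; have /setP/(_ b) := E0; rewrite !inE cQ bQ /=.
  by move: ca ba; rewrite -!val_eqE /= /cyclic; lia.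
rewrite inE => /andP[bQ ab] bmin; exists b; apply/next_inP; split=> //; first lia.
move=> c cQ; have := bmin c; rewrite inE cQ /= /cyclic; lia.
Qed.

(** A set that contains each block that it meets is a union of blocks. *)
Lemma dvdn_card_union n P A : partition P [set: 'I_N] ->
  (forall B, B \in P -> n %| #|B|) ->
  (forall B x y, B \in P -> x \in B -> x \in A -> y \in B -> y \in A) ->
  n %| #|A|.
Proof.
move=> PD Pn AP.
have -> : #|A| = \sum_(x in [set: 'I_N] | x \in A) 1.
  by rewrite -sum1_card; apply: eq_bigl => x; rewrite in_setT.
rewrite (set_partition_big_cond P PD); apply: dvdn_sum => B BP.
have [x /andP[xB xA]|h] := pickP [pred x | (x \in B) && (x \in A)]; last first.
  by rewrite big_pred0.
rewrite (eq_bigl (mem B)) ?sum1_card ?Pn // => y.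
by apply/andP/idP => [[]//|yB]; split=> //; apply: AP BP xB xA yB.
Qed.

Lemma card_ord_interval a b : a < b -> #|[set c : 'I_N | a < c < b]| = b - a.+1.
Proof.
move=> ab; have e := card_ord_lt (ltnW (ltn_ord b)).
have e' := card_ord_lt (ltn_ord a).
rewrite -[in b - _]e -[in _ - a.+1]e' -[X in X - _](cardID [pred c : 'I_N | c < a.+1]).
rewrite [X in X + _](_ : _ = #|[pred c : 'I_N | c < a.+1]|); last first.
  by apply: eq_card => c; rewrite !inE; lia.
rewrite addKn; apply: eq_card => c; rewrite !inE; lia.
Qed.

(** No block other than [B] has points on both sides of the chord from [a] to
    [b]. Hence the points cut off by this chord form a union of blocks, and
    their number is divisible by [n]. *)
Lemma next_in_mod n P B a b : partition P [set: 'I_N] -> noncrossing P ->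
  (forall B, B \in P -> n %| #|B|) -> B \in P -> next_in B a b ->
  b = a.+1 %[mod n].
Proof.
move=> PD nc Pn BP /next_inP[aB bB ab h].
have nb B' x y : B' \in P -> x \in B' -> y \in B' -> (x \in B) = false ->
    (x != a :> nat) && (x != b :> nat) && (y != a :> nat) && (y != b :> nat) &&
    (B' != B).
  move=> B'P xB' yB' xB; have nBB : B' != B by apply: contraFneq xB => <-.
  have ny z : z \in B' -> z \in B -> False.
    by move=> zB' zB; move/eqP: nBB; apply; apply: (partition_disj PD B'P BP zB').
  rewrite nBB andbT -!andbA; apply/and4P; split.
  - by apply/eqP => /val_inj xa; apply: (ny a) => //; rewrite -xa.
  - by apply/eqP => /val_inj xa; apply: (ny b) => //; rewrite -xa.
  - by apply/eqP => /val_inj xa; apply: (ny a) => //; rewrite -xa.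
  - by apply/eqP => /val_inj xa; apply: (ny b) => //; rewrite -xa.
have cross B' x y : B' \in P -> x \in B' -> y \in B' -> (x \in B) = false ->
    ~ [\/ [/\ y < a, a < x & x < b], [/\ a < x, x < b & b < y],
       [/\ y < b, b < x & x < a] | [/\ b < x, x < a & a < y]].
  move=> B'P xB' yB' xB; have /andP[_ /eqP nBB] := nb _ _ _ B'P xB' yB' xB.
  move=> [] [h1 h2 h3]; apply: nBB.
  - exact: (nc _ _ B'P BP y a x b).
  - exact/esym/(nc _ _ BP B'P a x b y).
  - exact: (nc _ _ B'P BP y b x a).
  - exact/esym/(nc _ _ BP B'P b x a y).
have [lt_ab|le_ba] := ltnP a b.
  apply/eqP; rewrite eqn_mod_dvd //.
  rewrite -card_ord_interval //; apply: (dvdn_card_union PD Pn) => B' x y B'P xB'.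
  rewrite !inE => xab yB'; have xB : (x \in B) = false.
    by apply/negP => /h; rewrite /cyclic; lia.
  have := cross _ _ _ B'P xB' yB' xB; have := nb _ _ _ B'P xB' yB' xB.
  move=> n1 c1; apply/negPn/negP => ny; apply: c1.
  have [?|?] := ltnP y a; [by constructor 1; split; lia|constructor 2; split; lia].
have lt_ba : b < a by rewrite ltn_neqAle eq_sym ab.
have cA : #|[set c : 'I_N | b <= c <= a]| = a.+1 - b.
  have -> : [set c : 'I_N | b <= c <= a] = a |: (b |: [set c : 'I_N | b < c < a]).
    by apply/setP => c; rewrite !inE -!val_eqE /=; lia.
  rewrite !cardsU1 card_ord_interval // !inE -!val_eqE /=; lia.
apply/eqP; rewrite eq_sym eqn_mod_dvd; last lia.
rewrite -cA; apply: (dvdn_card_union PD Pn) => B' x y B'P xB'.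
rewrite !inE => xab yB'; have [xB|xB] := boolP (x \in B).
  have BB : B' = B by apply: (partition_disj PD B'P BP xB').
  by move: yB'; rewrite BB => /h; rewrite /cyclic; lia.
move/negbTE: xB => xB.
have := cross _ _ _ B'P xB' yB' xB; have := nb _ _ _ B'P xB' yB' xB.
move=> n1 c1; apply/negPn/negP => ny; apply: c1.
have [?|?] := ltnP y b; [constructor 3; split; lia|constructor 4; split; lia].
Qed.

(** The sides of [Q], as pairs of indices, that lie over the side from vertex
    [k] to vertex [k + 1] when the point [x] lies over the vertex [x mod n]. *)
Definition sides_at n Q k : {set 'I_N * 'I_N} :=
  [set e | [&& next_in Q e.1 e.2, e.1 %% n == k & e.2 %% n == k.+1 %% n]].

Lemma sides_at_inj n Q k : {in sides_at n Q k &, injective fst}.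
Proof.
move=> [a b] [a' b']; rewrite !inE /= => /andP[ab _] /andP[a'b' _] e.
by rewrite -e in a'b' *; rewrite (next_in_uniq ab a'b').
Qed.

Definition residue_class n k : {set 'I_N} := [set x : 'I_N | x %% n == k].

End CyclicSides.

Section Portrait.
Local Open Scope nat_scope.
Variables (i n : nat).
Hypothesis n_gt1 : 1 < n.
Let T := 'I_(i * n).
Implicit Types (B Q : {set T}) (S : {set {set T}}) (a b x y : T).

(** Sibling portraits in terms of indices: every block covers all vertices, the
    blocks are disjoint and do not cross, and [i] sides lie over each side. *)
Definition cyclic_portrait S : Prop :=
  [/\ forall Q, Q \in S -> forall k, k < n -> exists2 x, x \in Q & x %% n = k,
      trivIset S, noncrossing S
    & forall k, k < n -> \sum_(Q in S) #|sides_at n Q k| = i].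

Lemma card_residue_class k : k < n -> #|residue_class (i * n) n k| = i.
Proof.
move=> kn; have lt j : j < i -> j * n + k < i * n by nia.
rewrite -[RHS]card_ord -cardsT -(card_imset _ (_ : injective (fun j : 'I_i => Ordinal (lt j (ltn_ord j))))).
  apply: eq_card => x; rewrite inE; apply/eqP/imsetP => [xk|[j _ ->]] /=; last first.
    by rewrite modnMDl modn_small.
  have xi : x %/ n < i by rewrite ltn_divLR ?ltn_ord //; lia.
  exists (Ordinal xi) => //; apply/val_inj => /=; rewrite -xk; exact: divn_eq.
by move=> j j' [] h; apply/val_inj => /=; nia.
Qed.

Lemma divisible_partition_next S Q x : partition S [set: T] -> noncrossing S ->
  (forall Q, Q \in S -> n %| #|Q|) -> Q \in S -> x \in Q ->
  exists y, next_in Q x y /\ y = x.+1 %[mod n].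
Proof.
move=> PS nc Sn QS xQ; have [|y xy] := @next_in_ex _ Q x _ xQ.
  by apply: leq_trans n_gt1 (dvdn_leq _ (Sn Q QS)); rewrite card_gt0; apply/set0Pn; exists x.
by exists y; split=> //; apply: (next_in_mod PS nc Sn QS xy).
Qed.

Lemma cyclic_portrait_of_partition S : partition S [set: T] -> noncrossing S ->
  (forall Q, Q \in S -> n %| #|Q|) -> cyclic_portrait S.
Proof.
move=> PS nc Sn; have nx := divisible_partition_next PS nc Sn; split=> //.
- move=> Q QS k kn; have /set0Pn[x0 x0Q] := partition_neq0 PS QS.
  have step j : exists2 x, x \in Q & x = x0 + j %[mod n].
    elim: j => [|j [x xQ xj]]; first by exists x0; rewrite ?addn0.
    have [y [/next_inP[_ yQ _ _] yx]] := nx _ _ QS xQ.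
    exists y => //; rewrite yx addnS -addn1 -modnDml xj modnDml addn1 //.
  (* The shift is [k - x0] modulo [n], written without a negative difference. *)
  have [x xQ xk] := step (k + (n - x0 %% n)); exists x => //.
  rewrite xk -modnDml.
  have -> : x0 %% n + (k + (n - x0 %% n)) = k + n.
    by have := ltn_pmod x0 (ltnW n_gt1); lia.
  by rewrite modnDr modn_small.
- by case/and3P: PS.
move=> k kn; rewrite -[RHS](card_residue_class kn).
have -> : #|residue_class (i * n) n k| =
    \sum_(x in [set: T] | x \in residue_class (i * n) n k) 1.
  by rewrite -sum1_card; apply: eq_bigl => x; rewrite in_setT.
rewrite (set_partition_big_cond S PS); apply: eq_bigr => Q QS.
rewrite -(card_in_imset (@sides_at_inj _ n Q k)) -sum1_card; apply: eq_bigl => x.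
rewrite inE; apply/imsetP/andP => [[[a b]]|[xQ xk]].
  by rewrite inE /= => /and3P[/next_inP[aQ _ _ _] ak _] ->.
have [y [xy yx]] := nx _ _ QS xQ; exists (x, y) => //; rewrite inE /= xy xk yx.
by rewrite -addn1 -modnDml (eqP xk) addn1 eqxx.
Qed.

Section FromPortrait.
Variable S : {set {set T}}.
Hypothesis PS : cyclic_portrait S.

(** Sides over side [k] start at distinct points with residue [k]. There are
    [i] such sides and only [i] such points, so that every point with residue
    [k] is used, and the side that starts there leads to residue [k + 1]. *)
Lemma cyclic_portrait_next x : exists Q y,
  [/\ Q \in S, x \in Q, next_in Q x y & y = x.+1 %[mod n]].
Proof.
have [_ tI _ sumS] := PS; pose k := x %% n.
have kn : k < n by rewrite ltn_pmod // ltnW.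
(* The points where a side over side [k] starts. *)
pose E := [set a : T | (a %% n == k) && [exists Q in S, (a \in Q) &&
  [exists b : T, next_in Q a b && (b %% n == k.+1 %% n)]]].
suff : E = residue_class (i * n) n k.
  move=> /setP/(_ x); rewrite !inE eqxx /= => /exists_inP[Q QS /andP[xQ /existsP[y]]].
  case/andP => xy /eqP yk; exists Q, y; split=> //.
  by rewrite yk /k -addn1 modnDml addn1.
apply/eqP; rewrite eqEcard card_residue_class //; apply/andP; split.
  by apply/subsetP => a; rewrite !inE => /andP[].
rewrite -[X in X <= _](sumS k kn); apply: (@leq_trans (\sum_(Q in S) \sum_(a in Q | a \in E) 1)).
  apply: leq_sum => Q QS; rewrite -(card_in_imset (@sides_at_inj _ n Q k)) sum1_card.
  apply/subset_leq_card/subsetP => _ /imsetP[[a b] + ->]; rewrite inE /= => /and3P[ab ak bk].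
  rewrite unfold_in /= inE ak.
  have /next_inP[aQ _ _ _] := ab; rewrite aQ /=.
  by apply/exists_inP; exists Q; rewrite // aQ; apply/existsP; exists b; rewrite ab.
rewrite -big_trivIset_cond // sum1_card.
by apply/subset_leq_card/subsetP => a /andP[].
Qed.

Lemma cyclic_portrait_partition : partition S [set: T].
Proof.
have [lab tI _ _] := PS; apply/and3P; split=> //.
  apply/eqP/setP => x; rewrite in_setT; have [Q [_ [QS xQ _ _]]] := cyclic_portrait_next x.
  by apply/bigcupP; exists Q.
by apply/negP => /lab /(_ 0 (ltnW n_gt1))[x]; rewrite inE.
Qed.

(** Passing to the next point of [Q] is injective and maps the points with residue
    [k] to points with residue [k + 1]. The numbers of points of each
    residue thus increase weakly around a cycle, so they are equal. *)
Lemma cyclic_portrait_dvdn Q : Q \in S -> n %| #|Q|.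
Proof.
move=> QS; have [_ tI _ _] := PS.
have nx x : x \in Q -> exists y, next_in Q x y /\ y = x.+1 %[mod n].
  move=> xQ; have [Q' [y [Q'S xQ' xy yx]]] := cyclic_portrait_next x.
  exists y; split=> //.
  by rewrite (partition_disj cyclic_portrait_partition QS Q'S xQ xQ').
pose c k := #|[set x in Q | x %% n == k]|.
have cS k : k < n -> c k <= c (k.+1 %% n).
  move=> kn; pose f x := odflt x [pick y | next_in Q x y].
  have fE x y : next_in Q x y -> f x = y.
    rewrite /f; case: pickP => [z xz xy|/(_ y) -> //] /=; exact: next_in_uniq xz xy.
  rewrite /c -(@card_in_imset _ _ f); last first.
    move=> x x'; rewrite !inE => /andP[/nx[y [xy _]] _] /andP[/nx[y' [xy' _]] _].
    by rewrite (fE _ _ xy) (fE _ _ xy') => e; move: xy'; rewrite -e; apply: next_in_inj.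
  apply/subset_leq_card/subsetP => _ /imsetP[x + ->]; rewrite inE => /andP[/nx[y [xy yx]] /eqP xk].
  rewrite (fE _ _ xy) inE yx -addn1 -modnDml xk addn1 eqxx andbT.
  by case/next_inP: xy.
have c0 k : k < n -> c k = c 0.
  have mono j l : j + l < n -> c j <= c (j + l).
    elim: l => [|l IH] jl; first by rewrite addn0.
    apply: leq_trans (IH _) _; first by lia.
    have jn : j + l < n by lia.
    by have := cS _ jn; rewrite modn_small -addnS.
  move=> kn; apply/eqP; rewrite eqn_leq; apply/andP; split; last by apply: (mono 0).
  apply: (@leq_trans (c n.-1)).
    have e : k + (n.-1 - k) = n.-1 by lia.
    by rewrite -[X in _ <= c X]e mono // e; lia.
  have n1 : n.-1 < n by lia.
  by have := cS _ n1; rewrite prednK ?modnn //; lia.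
have -> : #|Q| = \sum_(k < n) c k.
  have n0 : 0 < n by lia.
  rewrite -sum1_card (partition_big (fun x : T => Ordinal (ltn_pmod x n0)) predT) //=.
  apply: eq_bigr => k _; rewrite /c -sum1_card; apply: eq_bigl => x.
  by rewrite inE -val_eqE.
rewrite (eq_bigr (fun=> c 0)) => [|k _]; last exact: c0.
by rewrite sum_nat_const card_ord dvdn_mulr.
Qed.

(** A block meets all [n] residues, so it meets each of them once exactly when it
    has [n] points. *)
Lemma cyclic_portrait_injective Q : Q \in S ->
  {in Q &, forall x y, x = y %[mod n] -> x = y} <-> #|Q| = n.
Proof.
move=> QS; have [lab _ _ _] := PS; have n0 : 0 < n by lia.
pose f (x : T) := Ordinal (ltn_pmod x n0).
have fQ : f @: Q = [set: 'I_n].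
  apply/setP => k; rewrite in_setT; apply/imsetP.
  by have [x xQ xk] := lab Q QS k (ltn_ord k); exists x => //; apply/val_inj.
have nE : #|f @: Q| = n by rewrite fQ cardsT card_ord.
split=> [inj|Qn].
  rewrite -[RHS]nE card_in_imset // => x y xQ yQ /(congr1 val) /=; exact: inj.
have /imset_injP fI : #|f @: Q| == #|Q| by rewrite nE Qn.
by move=> x y xQ yQ xy; apply: fI => //; apply/val_inj.
Qed.

End FromPortrait.
End Portrait.

From mathcomp Require Import all_order all_algebra finmap.
From mathcomp Require Import all_classical all_reals all_analysis.
From mathcomp Require Import ring lra.

(** * The two counts agree *)

Section Counting.
Local Open Scope nat_scope.
Local Open Scope classical_set_scope.
Local Open Scope card_scope.

(** A lattice word ends with a down-step, so it splits uniquely into runs of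
    up-steps, each of them closed by a down-step. *)
Lemma card_lukasiewicz_dvd n i : 0 < n ->
  [set s | [/\ size s = i * n, all (dvdn n) s & lukasiewicz 0 s]] #=
  [set w | size w = i * n.+1 /\ dyck n 0 w].
Proof.
move=> n0; pose f (s : seq nat) := ups_word [seq j %/ n | j <- s].
set A := (X in X #= _); have fK s : all (dvdn n) s ->
    [seq n * j | j <- [seq j %/ n | j <- s]] = s.
  move=> /allP sn; rewrite -map_comp map_id_in // => j /sn /=.
  by rewrite mulnC => /divnK.
suff <- : f @` A = [set w | size w = i * n.+1 /\ dyck n 0 w].
  rewrite card_eq_sym; apply: inj_card_eq => s t.
  rewrite !inE => -[_ sn _] [_ tn _] /ups_word_inj st.
  by rewrite -(fK s) // st fK.
apply/seteqP; split=> [_ [s [ss sn sl] <-]|w [sw dw]] /=.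
  have dw : dyck n 0 (f s) by rewrite /f dyck_ups_word fK.
  split=> //; have := dyck_count dw; rewrite -[size _](count_predC id) /f.
  rewrite -[count (predC id) _]/(count negb _).
  by have [-> ->] := ups_word_count [seq j %/ n | j <- s]; rewrite size_map ss; nia.
have [s sE] := ups_word_surj (dyck_last n0 dw).
exists [seq n * j | j <- s]; last first.
  by rewrite /f -map_comp map_id_in // => j _ /=; rewrite mulKn.
have [e1 e2] := ups_word_count s; split.
- have := dyck_count dw; rewrite -sE e1 e2 size_map add0n.
  have := sw; rewrite -(count_predC id) -sE e2.
  rewrite -[count (predC id) _]/(count negb _) e1; nia.
- by apply/allP => _ /mapP[j _ ->]; rewrite dvdn_mulr.
- by rewrite -dyck_ups_word sE.
Qed.

(** The letters [n + 1] and 0 move by [n] and by [-1]. *)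
Lemma card_lukasiewicz_eq n i :
  [set s | [/\ size s = i * n.+1, all (fun j => (j == 0) || (j == n.+1)) s &
     lukasiewicz 0 s]] #=
  [set w | size w = i * n.+1 /\ dyck n 0 w].
Proof.
pose g (w : bitseq) := [seq if b then n.+1 else 0 | b <- w].
set A := (X in X #= _); set W := (X in _ #= X).
have lg h w : lukasiewicz h (g w) = dyck n h w.
  elim: w h => [|[] w IH] h //=; by rewrite IH ?addn0 // addnS.
suff -> : A = g @` W.
  apply: inj_card_eq => w w' _ _; apply: inj_map; by case; case.
apply/seteqP; split=> [s [ss /allP sn sl]|_ [w [sw dw] <-]] /=; last first.
  split; rewrite ?size_map ?lg //.
  by apply/allP => _ /mapP[[] _ ->] //=; rewrite eqxx orbT.
have sE : g [seq j != 0 | j <- s] = s.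
  rewrite /g -map_comp map_id_in // => j /sn /orP[]/eqP -> //.
by exists [seq j != 0 | j <- s] => //; split; rewrite ?size_map // -lg sE.
Qed.



Lemma card_noncrossing_partition N (p : pred nat) : p 0 ->
  [set P : {set {set 'I_N}} | [/\ finset.partition P (finset.setTfor 'I_N),
     noncrossing P & forall B, B \in P -> p #|B|]] #=
  [set s | [/\ size s = N, all p s & lukasiewicz 0 s]].
Proof.
move=> p0; set A := (X in X #= _); set C := (X in _ #= X).
suff <- : @opening_word N @` A = C.
  rewrite card_eq_sym; apply: inj_card_eq => P P' /set_mem[PD nc _] /set_mem[PD' nc' _].
  exact: opening_word_inj.
apply/seteqP; split=> [_ [P [PD nc pP] <-]|s [sN ps ls]] /=.
  split; [exact: size_opening_word| |exact: lukasiewicz_opening_word].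
  by rewrite all_opening_word //; apply/forall_inP.
have [P [PD nc oP]] := opening_word_surj sN ls; exists P => //; split=> //.
by apply/forall_inP; rewrite -(all_opening_word PD) ?oP.
Qed.

Lemma card_cyclic_portraits i n : 1 < n -> exists M : nat,
  [set S | @cyclic_portrait i n S] #= `I_M /\
  [set S | @cyclic_portrait i n.+1 S /\ forall Q, Q \in S ->
     {in Q &, forall x y : 'I_(i * n.+1), x = y %[mod n.+1] -> x = y}] #= `I_M.
Proof.
move=> n1; pose F := [set S | @cyclic_portrait i n S].
pose f := [set S | @cyclic_portrait i n.+1 S /\ forall Q, Q \in S ->
  {in Q &, forall x y : 'I_(i * n.+1), x = y %[mod n.+1] -> x = y}].
have /finite_setP[M FM] : finite_set F by exact: finite_finset.
exists M; split=> //; apply: card_eq_trans FM.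
suff [F1 f1] : F #= [set s | [/\ size s = i * n, all (dvdn n) s & lukasiewicz 0 s]] /\
    f #= [set s | [/\ size s = i * n.+1, all (fun j => (j == 0) || (j == n.+1)) s &
     lukasiewicz 0 s]].
  apply: (card_eq_trans f1); apply: (card_eq_trans (card_lukasiewicz_eq n i)).
  rewrite card_eq_sym; apply: (card_eq_trans F1).
  exact: card_lukasiewicz_dvd (ltnW n1).
split.
  apply: card_eq_trans (card_noncrossing_partition (i * n) (dvdn0 n)).
  set C := (X in _ #= X); suff -> : F = C by exact: card_eqxx.
  apply/seteqP; split=> S /=.
    move=> PS; split; [exact: cyclic_portrait_partition PS|by case: PS|].
    by move=> B BS; apply: (cyclic_portrait_dvdn n1 PS BS).
  by case; apply: cyclic_portrait_of_partition.
have n2 : 1 < n.+1 by lia.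
pose p := fun j => (j == 0) || (j == n.+1).
apply: card_eq_trans (card_noncrossing_partition (p := p) (i * n.+1) isT).
set C := (X in _ #= X); suff -> : f = C by exact: card_eqxx.
apply/seteqP; split=> S /=.
  move=> [PS inj]; split; [exact: (cyclic_portrait_partition n2 PS)|by case: PS|].
  move=> B BS; apply/orP; right; apply/eqP.
  by apply/(cyclic_portrait_injective n2 PS BS); exact: inj.
move=> [PD nc Sp].
have Sn B : B \in S -> #|B| = n.+1.
  move=> BS; have := Sp B BS; rewrite /p; have := partition_neq0 PD BS.
  by rewrite -card_gt0; case: #|B| => //= m _ /eqP.
have PS : cyclic_portrait S.
  by apply: (cyclic_portrait_of_partition n2 PD nc) => Q /Sn ->.
by split=> // Q QS; apply/(cyclic_portrait_injective n2 PS QS); exact: Sn.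
Qed.

End Counting.

Import Order.TTheory GRing.Theory Num.Theory.
Import numFieldNormedType.Exports.

Local Open Scope classical_set_scope.
Local Open Scope ring_scope.

(** * Points of the disk *)

Section Plane.
Variable R : realType.
Implicit Types (a b c x y z : plane R) (t u : R) (A C : set (plane R)).

Lemma orient_rot a b c : orient b c a = orient a b c.
Proof. by rewrite /orient; ring. Qed.

Lemma orient_swap a b c : orient b a c = - orient a b c.
Proof. by rewrite /orient; ring. Qed.

Lemma orient_convex a b x y t :
  orient a b ((1 - t) *: x + t *: y) = (1 - t) * orient a b x + t * orient a b y.
Proof. by rewrite /orient /= /GRing.scale /=; ring. Qed.

Lemma orient_line a b t : orient a b ((1 - t) *: a + t *: b) = 0.
Proof. by rewrite /orient /= /GRing.scale /=; ring. Qed.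

Lemma orientaa a c : orient a a c = 0.
Proof. by rewrite /orient; ring. Qed.

Lemma plane_eqP x y : x.1 = y.1 -> x.2 = y.2 -> x = y.
Proof. by case: x y => [? ?] [? ?] /= -> ->. Qed.

Lemma neq_sqdist a b : a != b -> 0 < (b.1 - a.1) ^+ 2 + (b.2 - a.2) ^+ 2.
Proof.
move=> ab; rewrite lt_neqAle eq_sym addr_ge0 ?sqr_ge0 // andbT.
rewrite paddr_eq0 ?sqr_ge0 // !sqrf_eq0 !subr_eq0.
apply: contra ab => /andP[/eqP e1 /eqP e2]; apply/eqP; exact: plane_eqP.
Qed.

(** The parameter is that of the orthogonal projection of [z] to the line. *)
Lemma orient0_line a b z : a != b -> orient a b z = 0 ->
  exists t, z = (1 - t) *: a + t *: b.
Proof.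
move=> /neq_sqdist; set D := _ + _ => D0 o; have Dn0 : D != 0 by rewrite gt_eqF.
pose s := (z.1 - a.1) * (b.1 - a.1) + (z.2 - a.2) * (b.2 - a.2).
exists (s / D); apply: plane_eqP; rewrite /= /GRing.scale /=.
  have e : s * (b.1 - a.1) = (z.1 - a.1) * D + (b.2 - a.2) * orient a b z.
    by rewrite /s /D /orient; ring.
  transitivity (a.1 + s * (b.1 - a.1) / D); last by ring.
  by rewrite e o mulr0 addr0 mulfK // subrKC.
have e : s * (b.2 - a.2) = (z.2 - a.2) * D - (b.1 - a.1) * orient a b z.
  by rewrite /s /D /orient; ring.
transitivity (a.2 + s * (b.2 - a.2) / D); last by ring.
by rewrite e o mulr0 subr0 mulfK // subrKC.
Qed.

Lemma disk_convex_comb x y t : unit_disk x -> unit_disk y -> 0 <= t <= 1 ->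
  unit_disk ((1 - t) *: x + t *: y).
Proof.
rewrite /unit_disk /= /GRing.scale /= => dx dy /andP[t0 t1].
set u := (X in X <= 1).
have : 0 <= t * (1 - t) * ((y.1 - x.1) ^+ 2 + (y.2 - x.2) ^+ 2).
  by rewrite mulr_ge0 ?addr_ge0 ?sqr_ge0 // mulr_ge0 // subr_ge0.
have -> : u = (1 - t) * (x.1 ^+ 2 + x.2 ^+ 2) + t * (y.1 ^+ 2 + y.2 ^+ 2)
  - t * (1 - t) * ((y.1 - x.1) ^+ 2 + (y.2 - x.2) ^+ 2) by rewrite /u; ring.
by nra.
Qed.

Lemma circle_disk x : unit_circle x -> unit_disk x.
Proof. by rewrite /unit_circle /unit_disk /= => ->. Qed.

(** The power of a point of the chord, which governs where a line
    leaves the disk. *)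
Lemma circle_sqnorm a b t : unit_circle a -> unit_circle b ->
  ((1 - t) *: a + t *: b).1 ^+ 2 + ((1 - t) *: a + t *: b).2 ^+ 2 =
  1 - t * (1 - t) * ((b.1 - a.1) ^+ 2 + (b.2 - a.2) ^+ 2).
Proof.
rewrite /unit_circle /= /GRing.scale /= => ha hb.
transitivity ((1 - t) * (a.1 ^+ 2 + a.2 ^+ 2) + t * (b.1 ^+ 2 + b.2 ^+ 2)
  - t * (1 - t) * ((b.1 - a.1) ^+ 2 + (b.2 - a.2) ^+ 2)); first by ring.
by rewrite ha hb; ring.
Qed.

Lemma disk_line_chord a b z : unit_circle a -> unit_circle b -> a != b ->
  unit_disk z -> orient a b z = 0 -> chord a b z.
Proof.
move=> ha hb ab dz /(orient0_line ab)[t zE]; exists t => //.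
have := circle_sqnorm t ha hb; have := neq_sqdist ab.
move: dz; rewrite /unit_disk /= zE => dz D0 e.
rewrite e in dz; have := @ler_pM2r _ _ D0 0 (t * (1 - t)).
rewrite mul0r; set p := t * (1 - t) * _ in dz *.
have -> : 0 <= p by lra.
by move=> /esym h; apply/andP; split; nra.
Qed.

Lemma circle_chord_end a b t : unit_circle a -> unit_circle b -> a != b ->
  unit_circle ((1 - t) *: a + t *: b) -> t = 0 \/ t = 1.
Proof.
move=> ha hb ab; rewrite {1}/unit_circle /= => e; have := circle_sqnorm t ha hb.
have := neq_sqdist ab; rewrite [X in _ -> X = _ -> _]e => D0 /esym/eqP.
rewrite subr_eq addrC -subr_eq subrr eq_sym !mulf_eq0 (gt_eqF D0) orbF subr_eq0.
by case/orP => /eqP; auto.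
Qed.

Lemma circle_orient_neq0 a b c : unit_circle a -> unit_circle b ->
  unit_circle c -> a != b -> c != a -> c != b -> orient a b c != 0.
Proof.
move=> ha hb hc ab ca cb; apply/eqP => /(orient0_line ab)[t cE].
move: (hc); rewrite cE => /(circle_chord_end ha hb ab)[] t0; move: cE;
  rewrite t0 ?subrr ?subr0 ?scale1r ?scale0r ?addr0 ?add0r => /eqP.
- by rewrite (negPf ca).
- by rewrite (negPf cb).
Qed.

Lemma convex_setP A : convex_set A <->
  forall x y t, 0 <= t <= 1 -> A x -> A y -> A ((1 - t) *: x + t *: y).
Proof.
split=> [cA x y t /andP[t0 t1] Ax Ay|cA x y k /set_mem Ax /set_mem Ay].
  have := cA y x (Itv01 t0 t1); rewrite !inE => /(_ Ay Ax).
  by rewrite addrC.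
apply/mem_set; have := cA y x k%:inum; rewrite addrC; apply=> //.
by rewrite ge0 le1.
Qed.

Lemma convex_left a b : convex_set [set z | 0 < orient a b z].
Proof.
apply/convex_setP => x y t /andP[t0 t1] /= ox oy.
rewrite orient_convex; nra.
Qed.

Lemma convex_right a b : convex_set [set z | orient a b z <= 0].
Proof.
apply/convex_setP => x y t /andP[t0 t1] /= ox oy.
rewrite orient_convex; nra.
Qed.

(** The four conditions say that [a b c d] is a convex quadrilateral traversed
    counterclockwise; its diagonals meet at a point whose coordinates on
    each diagonal are ratios of triangle areas. *)
Lemma chord_crossing a b c d : 0 < orient a b c -> 0 < orient b c d ->
  0 < orient c d a -> 0 < orient d a b -> chord a c `&` chord b d !=set0.
Proof.
move=> oabc obcd ocda odab.
pose u := orient a b c; pose v := orient c d a.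
pose p := orient d a b; pose q := orient b c d.
have uv : u + v = p + q by rewrite /u /v /p /q /orient; ring.
have D0 : 0 < u + v by rewrite addr_gt0.
have D0' : 0 < p + q by rewrite addr_gt0.
have frac (r r' : R) : 0 < r -> 0 < r' -> 0 <= r / (r + r') <= 1.
  move=> r0 r'0; apply/andP; split; first by rewrite divr_ge0 ?addr_ge0 ?ltW.
  by rewrite ler_pdivrMr ?addr_gt0 // mul1r lerDl ltW.
exists ((1 - u / (u + v)) *: b + (u / (u + v)) *: d); split; last first.
  by exists (u / (u + v)) => //; apply: frac.
exists (p / (p + q)); first exact: frac.
have comp (a' b' c' d' : R) : v * b' + u * d' = q * a' + p * c' ->
    (1 - u / (u + v)) * b' + u / (u + v) * d' =
    (1 - p / (p + q)) * a' + p / (p + q) * c'.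
  move=> e; transitivity ((v * b' + u * d') / (u + v)); first by field; rewrite gt_eqF.
  by rewrite e uv; field; rewrite gt_eqF.
by apply: plane_eqP; apply: comp; rewrite /u /v /p /q /orient; ring.
Qed.

End Plane.

(** * Polygons inscribed in the circle *)

Section ConvexHull.
Variable R : realType.
Implicit Types (x y : plane R) (A X : set (plane R)).

Lemma convex_hull_sub A X : convex_set A -> (convex_hull X `<=` A) <-> X `<=` A.
Proof.
move=> cA; split=> [h|]; last exact: smallest_sub.
by apply: subset_trans h; exact: sub_gen_smallest.
Qed.

Lemma chord_convex_hull X x y : X x -> X y -> chord x y `<=` convex_hull X.
Proof.
move=> Xx Xy z [t t01 ->] A [/convex_setP cA XA].
by apply: cA => //; apply: XA.
Qed.

End ConvexHull.

Section CcwEnum.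
Variables (R : realType) (N : nat) (c : 'I_N -> plane R).
Implicit Types (a b d x y : 'I_N) (Q : {set 'I_N}).

(** For [N <= 2] the orientation condition is void, which is why injectivity is
    stated separately. *)
Definition ccw_enum : Prop :=
  [/\ forall j, unit_circle (c j), injective c
    & forall a b d, (a < b)%N -> (b < d)%N -> 0 < orient (c a) (c b) (c d)].

Definition vertices Q : polygon R := [fset c x | x in Q]%fset.

Hypothesis ccw : ccw_enum.

Lemma mem_vertices Q x : (c x \in vertices Q) = (x \in Q).
Proof. by have [_ c_inj _] := ccw; rewrite /vertices mem_imfset. Qed.

Lemma verticesP Q p : reflect (exists2 x, x \in Q & p = c x) (p \in vertices Q).
Proof. exact: imfsetP. Qed.

Lemma card_vertices Q : #|` vertices Q| = #|Q|.
Proof. by have [_ c_inj _] := ccw; rewrite /vertices card_imfset //= -cardE. Qed.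

Lemma vertices_inj : injective vertices.
Proof. by move=> Q Q' e; apply/setP => x; rewrite -!mem_vertices e. Qed.

Lemma orient_ccw_enum a b d : (0 < orient (c a) (c b) (c d)) = cyclic a b d.
Proof.
have [_ _ o] := ccw.
have lt (p q r : 'I_N) : (p < q < r)%N -> 0 < orient (c p) (c q) (c r) by case/andP; apply: o.
have gt (p q r : 'I_N) : (p < q < r)%N -> (0 < orient (c q) (c p) (c r)) = false.
  by move/lt => h; rewrite orient_swap; apply/negbTE; rewrite -leNgt oppr_le0 ltW.
have eq p q : orient (c p) (c p) (c q) = 0 by rewrite orientaa.
rewrite /cyclic; have [/lt ->//|n1] := boolP (a < b < d)%N.
have [/lt|n2] := boolP (b < d < a)%N; first by rewrite orient_rot => ->.
have [/lt|n3] := boolP (d < a < b)%N; first by rewrite -orient_rot => ->.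
have [ab|ab] := eqVneq (a : nat) b; first by rewrite (val_inj ab) eq ltxx.
have [bd|bd] := eqVneq (b : nat) d; first by rewrite (val_inj bd) -orient_rot eq ltxx.
have [ad|ad] := eqVneq (a : nat) d.
  by rewrite (val_inj ad) -orient_rot -orient_rot eq ltxx.
have [/gt ->//|m1] := boolP (b < a < d)%N.
have [/gt|m2] := boolP (a < d < b)%N; first by rewrite -orient_rot => ->.
have [/gt|m3] := boolP (d < b < a)%N; first by rewrite orient_rot => ->.
by exfalso; lia.
Qed.

Lemma is_side_vertices Q a b : is_side (vertices Q) (c a, c b) = next_in Q a b.
Proof.
have [_ c_inj _] := ccw; rewrite /is_side /next_in /= !mem_vertices (inj_eq c_inj).
congr [&& _, _, _ & _]; apply/allP/forall_inP => [h x xQ|h _ /verticesP[x xQ ->]] /=.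
  by have := h (c x); rewrite mem_vertices /= !(inj_eq c_inj) orient_ccw_enum -orbA; apply.
by rewrite !(inj_eq c_inj) orient_ccw_enum -orbA h.
Qed.

Definition uncrossed Q Q' : Prop :=
  forall a b d e, a \in Q -> b \in Q' -> d \in Q -> e \in Q' ->
    ~ [/\ (a < b)%N, (b < d)%N & (d < e)%N].

Lemma crossed_regions Q Q' a b d e : a \in Q -> b \in Q' -> d \in Q -> e \in Q' ->
  (a < b)%N -> (b < d)%N -> (d < e)%N ->
  polygon_region (vertices Q) `&` polygon_region (vertices Q') !=set0.
Proof.
move=> aQ bQ' dQ eQ' ab bd de.
have [z [zac zbe]] : chord (c a) (c d) `&` chord (c b) (c e) !=set0.
  by apply: chord_crossing; rewrite orient_ccw_enum /cyclic; lia.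
by exists z; split;
  [move: zac|move: zbe]; apply: chord_convex_hull; rewrite /= mem_vertices.
Qed.

(** If all of [Q] lies outside the interval spanned by [Q'], then the line through
    the two extreme points of [Q'] separates the two polygons. *)
Lemma regions_separated Q Q' : (1 < #|Q'|)%N ->
  (forall m M : 'I_N, is_min Q' m -> (forall y, y \in Q' -> (y <= M)%N) -> M \in Q' ->
     forall x, x \in Q -> (x < m)%N || (M < x)%N) ->
  polygon_region (vertices Q) `&` polygon_region (vertices Q') = set0.
Proof.
move=> Q'1 out; have /ex_is_min[m mQ'] : Q' != finset.set0.
  by rewrite -card_gt0 ltnW.
have [m'Q' mmin] := is_minP _ _ mQ'.
case: (arg_maxnP (fun x : 'I_N => val x) m'Q') => M MQ' Mmax.
have mM : (m < M)%N.
  rewrite ltn_neqAle mmin // andbT; apply/eqP => /val_inj mM.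
  move: Q'1; rewrite ltnNge => /negP[]; apply/card_le1P => x xQ' y; rewrite inE.
  have al z : z \in Q' -> z = m.
    by move=> zQ'; apply/val_inj/eqP; rewrite eqn_leq mmin // andbT /= mM; exact: Mmax.
  by rewrite (al x xQ'); apply/idP/eqP => [/al //|->].
have sub : polygon_region (vertices Q) `<=` [set z | 0 < orient (c m) (c M) z].
  apply/convex_hull_sub; first exact: convex_left.
  move=> _ /verticesP[x xQ ->] /=; rewrite orient_ccw_enum /cyclic.
  have := out m M mQ' Mmax MQ' x xQ; lia.
have sub' : polygon_region (vertices Q') `<=` [set z | orient (c m) (c M) z <= 0].
  apply/convex_hull_sub; first exact: convex_right.
  move=> _ /verticesP[x xQ ->] /=; rewrite leNgt orient_ccw_enum /cyclic.
  have := mmin x xQ; have := Mmax x xQ; rewrite /=; lia.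
apply/seteqP; split=> // z [/sub /= h /sub' /=]; by rewrite leNgt h.
Qed.

(** When the two sets are disjoint and do not cross, one of them lies outside the
    interval spanned by the other. When they cross, two of their chords meet. *)
Lemma disjoint_regionsP Q Q' : (1 < #|Q|)%N -> (1 < #|Q'|)%N ->
  polygon_region (vertices Q) `&` polygon_region (vertices Q') = set0 <->
  [/\ [disjoint Q & Q']%B, uncrossed Q Q' & uncrossed Q' Q].
Proof.
move=> Q1 Q'1; split=> [e|[dj un un']].
  split.
  - rewrite -finset.setI_eq0; apply/eqP/setP => x; rewrite !inE; apply/negP => /andP[xQ xQ'].
    suff : set0 (c x) by []. rewrite -e.
    by split; apply: sub_gen_smallest; rewrite /= mem_vertices.
  - move=> a b d f aQ bQ dQ fQ [ab bd df].
    by have := crossed_regions aQ bQ dQ fQ ab bd df; rewrite e => -[].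
  - move=> a b d f aQ bQ dQ fQ [ab bd df].
    by have := crossed_regions aQ bQ dQ fQ ab bd df; rewrite setIC e => -[].
have nQ x y : x \in Q -> y \in Q' -> x != y :> nat.
  by move=> xQ yQ'; apply: contraTneq dj => /val_inj xy;
    rewrite -finset.setI_eq0; apply/finset.set0Pn; exists x; rewrite inE xQ xy.
have [m mQ'] : exists m, is_min Q' m by apply: ex_is_min; rewrite -card_gt0 ltnW.
have [m'Q' mmin] := is_minP _ _ mQ'.
case: (arg_maxnP (fun x : 'I_N => val x) m'Q') => M MQ' Mmax.
have [/existsP[q /and3P[qQ mq qM]]|/existsPn none] :=
  boolP [exists q, [&& q \in Q, (m < q)%N & (q < M)%N]]; last first.
  apply: regions_separated => // m1 M1 m1Q' M1max M1Q' x xQ.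
  have em : m1 = m := is_min_uniq m1Q' mQ'.
  have eM : M1 = M by apply/val_inj/eqP; rewrite eqn_leq; apply/andP; split; [exact: Mmax|exact: M1max].
  rewrite em eM; have := none x; rewrite xQ /=; have := nQ x m xQ m'Q'.
  have := nQ x M xQ MQ'; lia.
rewrite setIC; apply: regions_separated => // p r pQ rmax rQ x xQ'.
have [p'Q pmin] := is_minP _ _ pQ.
have /(_ p p'Q) ins : forall y, y \in Q -> (m < y < M)%N.
  move=> y yQ; have := nQ y m yQ m'Q'; have := nQ y M yQ MQ' => ? ?.
  have [ym|my] := ltnP y m; first by case: (un y m q M) => //; split.
  have [My|yM] := ltnP M y; first by case: (un' m q M y) => //; split.
  by lia.
have := nQ p x p'Q xQ'; have := nQ r x rQ xQ' => ? ?.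
have [?|?] := ltnP x p; first by [].
have [?|?] := ltnP r x; first by rewrite orbT.
by case: (un' m p x r) => //; split; lia.
Qed.

End CcwEnum.

(** * From portraits to noncrossing partitions *)

Section PortraitReduction.
Variables (R : realType) (d i n : nat) (n_gt1 : (1 < n)%N).
Variables (G : set (plane R)) (P : polygon R).
Variables (v : 'I_n -> plane R) (c : 'I_(i * n) -> plane R).
Hypothesis G_convex : convex_set G.
Hypotheses (v_ccw : ccw_enum v) (P_v : P = vertices v [set: 'I_n]%SET).
Hypothesis c_ccw : ccw_enum c.
Let n_gt0 : (0 < n)%N := ltnW n_gt1.
Let label (j : nat) : 'I_n := Ordinal (ltn_pmod j n_gt0).
Hypothesis sigma_c : forall j, sigma d (c j) = v (label j).
Hypothesis c_surj : forall x, G x -> unit_circle x -> sigma d x \in P ->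
  exists j, x = c j.
Hypothesis c_G : forall j, G (c j).

Implicit Types (Q : {set 'I_(i * n)}) (T : {set {set 'I_(i * n)}}).

Definition vertex_sets T : {fset polygon R} := [fset vertices c Q | Q in T]%fset.

Lemma mem_vertex_sets T Q : (vertices c Q \in vertex_sets T) = (Q \in T).
Proof. by rewrite /vertex_sets mem_imfset //; exact: vertices_inj. Qed.

Lemma vertex_setsP T q :
  reflect (exists2 Q, Q \in T & q = vertices c Q) (q \in vertex_sets T).
Proof. exact: imfsetP. Qed.

Lemma vertex_sets_inj : injective vertex_sets.
Proof. by move=> T T' e; apply/setP => Q; rewrite -!mem_vertex_sets e. Qed.

Lemma next_in_setT (a b : 'I_n) :
  next_in [set: 'I_n]%SET a b = (b %% n == a.+1 %% n)%N.
Proof.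
have an := ltn_ord a; have bn := ltn_ord b.
have E : (a.+1 %% n = if a.+1 == n then 0 else a.+1)%N.
  have [->|ne] := eqVneq a.+1 n; first by rewrite modnn.
  by rewrite modn_small // ltn_neqAle ne.
rewrite E (modn_small bn); apply/next_inP/eqP => [[_ _ ab h]|bE].
  have [aE|aE] := eqVneq a.+1 n.
    by have := h (label 0) (finset.in_setT _); rewrite /= mod0n /cyclic; lia.
  have := h (label a.+1) (finset.in_setT _); rewrite /= E (negPf aE) /cyclic; lia.
split; rewrite ?finset.in_setT //; first by move: bE; case: eqP; lia.
move=> x _; have := ltn_ord x; rewrite /cyclic; move: bE; case: eqP; lia.
Qed.

Lemma sides_P (e : plane R * plane R) : e \in sides P <->
  exists2 k, (k < n)%N & e = (v (label k), v (label k.+1)).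
Proof.
rewrite !inE P_v; split.
  case: e => x y /= /andP[/andP[/verticesP[a _ ->] /verticesP[b _ ->]]].
  rewrite is_side_vertices // next_in_setT => /eqP ba; exists a => //.
  by congr (v _, v _); apply/val_inj; rewrite /= -?ba modn_small.
move=> [k kn ->] /=; rewrite is_side_vertices // !mem_vertices // !finset.in_setT /=.
by rewrite next_in_setT /= modn_mod -addn1 -[in X in _ == X]addn1 modnDml.
Qed.

Lemma card_sides_over Q k : (k < n)%N ->
  #|` sides_over d (vertices c Q) (v (label k), v (label k.+1))| =
  #|sides_at n Q k|.
Proof.
move=> kn; have [_ c_inj _] := c_ccw; have [_ v_inj _] := v_ccw.
pose f (e : 'I_(i * n) * 'I_(i * n)) := (c e.1, c e.2).
have f_inj : injective f by move=> [? ?] [? ?] [/c_inj -> /c_inj ->].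
have lab a b : ((v (label a), v (label b)) == (v (label k), v (label k.+1))) =
   (a %% n == k)%N && (b %% n == k.+1 %% n)%N.
  rewrite xpair_eqE !(inj_eq v_inj) -!val_eqE /= (modn_small kn) //.
transitivity #|` [fset f e | e in sides_at n Q k]%fset|; last first.
  by rewrite card_imfset //= -cardE.
congr (#|` _|); apply/fsetP => -[x y].
rewrite !inE /=; apply/andP/imfsetP => [[/andP[/andP[]]]|[[a b]]].
  move=> /verticesP[a aQ ->] /verticesP[b bQ ->].
  rewrite is_side_vertices // !sigma_c lab => ab h.
  by exists (a, b) => //=; rewrite inE ab.
rewrite /= inE /= => /andP[ab h] [-> ->].
rewrite !sigma_c lab h is_side_vertices // ab !mem_vertices //.
by have /next_inP[-> -> _ _] := ab.
Qed.

Lemma polygon_image_verticesP Q : polygon_image d (vertices c Q) = P <->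
  (forall k, (k < n)%N -> exists2 x, x \in Q & (x %% n)%N = k).
Proof.
have [_ v_inj _] := v_ccw; rewrite P_v; split=> [e k kn|h].
  have : v (label k) \in polygon_image d (vertices c Q).
    by rewrite e mem_vertices // finset.in_setT.
  case/imfsetP => _ /= /verticesP[x xQ ->]; rewrite sigma_c => /v_inj/(congr1 val) /=.
  by rewrite modn_small // => ->; exists x.
apply/fsetP => y; apply/imfsetP/verticesP => [[_ /= /verticesP[x xQ ->] ->]|[k _ ->]].
  by exists (label x); rewrite ?finset.in_setT.
have [x xQ xk] := h k (ltn_ord k); exists (c x); first by rewrite /= mem_vertices.
by rewrite sigma_c; congr v; apply/val_inj.
Qed.

Lemma sum_sides_over T k : (k < n)%N ->
  (\sum_(q <- vertex_sets T) #|` sides_over d q (v (label k), v (label k.+1))| =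
  \sum_(Q in T) #|sides_at n Q k|)%N.
Proof.
move=> kn; rewrite big_imfset /=; last by move=> ? ? _ _; exact: vertices_inj.
by rewrite big_enum; apply: eq_bigr => Q _; exact: card_sides_over.
Qed.

Lemma sibling_portrait_vertex_sets T :
  sibling_portrait d G i P (vertex_sets T) <-> cyclic_portrait T.
Proof.
split=> [[h1 h2 h3]|[h1 h2 h3 h4]].
  have lab Q : Q \in T -> forall k, (k < n)%N -> exists2 x, x \in Q & (x %% n)%N = k.
    by move=> QT; apply/polygon_image_verticesP; have [|] := h1 (vertices c Q); rewrite ?mem_vertex_sets.
  have Q1 Q : Q \in T -> (1 < #|Q|)%N.
    move=> QT; have [|[m [_ m2 mE]] _ _] := h1 (vertices c Q); first by rewrite mem_vertex_sets.
    by rewrite -(card_vertices c_ccw) mE.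
  have dj Q Q' : Q \in T -> Q' \in T -> Q != Q' ->
      [/\ [disjoint Q & Q']%B, uncrossed Q Q' & uncrossed Q' Q].
    move=> QT Q'T QQ'; apply/(disjoint_regionsP c_ccw (Q1 _ QT) (Q1 _ Q'T)).
    by apply: h2; rewrite ?mem_vertex_sets // (inj_eq (vertices_inj c_ccw)).
  split=> //.
  - by apply/finset.trivIsetP => Q Q' QT Q'T /(dj _ _ QT Q'T)[].
  - move=> Q Q' QT Q'T p q r s pQ qQ' rQ sQ' pq qr rs; apply/eqP/negPn/negP.
    by case/(dj _ _ QT Q'T) => _ /(_ p q r s pQ qQ' rQ sQ')[].
  - by move=> k kn; rewrite -sum_sides_over // h3 //; apply/sides_P; exists k.
have Q1 Q : Q \in T -> (1 < #|Q|)%N.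
  move=> QT; have [x xQ x0] := h1 Q QT 0%N n_gt0; have [y yQ y1] := h1 Q QT 1%N n_gt1.
  apply/card_gt1P; exists x, y; split=> //.
  by apply: contra_eq_neq y1 => <-; rewrite x0.
split.
- move=> _ /vertex_setsP[Q QT ->]; split; last exact/polygon_image_verticesP/h1.
    exists #|Q|; split; rewrite ?card_vertices ?Q1 //.
    by move=> _ /verticesP[x _ ->]; have [] := c_ccw.
  by apply/convex_hull_sub => // _ /verticesP[x _ ->].
- move=> _ _ /vertex_setsP[Q QT ->] /vertex_setsP[Q' Q'T ->].
  rewrite (inj_eq (vertices_inj c_ccw)) => QQ'.
  apply/(disjoint_regionsP c_ccw (Q1 _ QT) (Q1 _ Q'T)); split.
  + by move/finset.trivIsetP: h2; apply.
  + move=> p q r s pQ qQ' rQ sQ' [pq qr rs]; move/eqP: QQ'; apply.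
    exact: (h3 Q Q' QT Q'T p q r s).
  + move=> p q r s pQ qQ' rQ sQ' [pq qr rs]; move/eqP: QQ'; apply.
    exact/esym/(h3 Q' Q Q'T QT p q r s).
- by move=> e /sides_P[k kn ->]; rewrite sum_sides_over // h4.
Qed.

Lemma sibling_portrait_is_vertex_sets S : sibling_portrait d G i P S ->
  exists T, S = vertex_sets T.
Proof.
move=> [h1 _ _]; exists (finset (fun Q => vertices c Q \in S)).
apply/fsetP => q; apply/idP/vertex_setsP => [qS|[Q + ->]]; last by rewrite inE.
have [[m [qc _ _]] qG qP] := h1 q qS.
pose Q := finset (fun j => c j \in q); suff qE : q = vertices c Q.
  by exists Q; rewrite // inE -qE.
apply/fsetP => x; apply/idP/verticesP => [xq|[j + ->]]; last by rewrite inE.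
have [||j xj] := @c_surj x _ (qc _ xq).
- by apply: qG; apply: sub_gen_smallest.
- by rewrite -qP; apply: in_imfset.
by exists j; rewrite // inE -xj.
Qed.

(** A vertex set is a subset of the list [c], which makes [vertex_sets] a
    bijection onto the sibling portraits. *)
Lemma card_sibling_portraits :
  ([set S | sibling_portrait d G i P S] #= [set T | @cyclic_portrait i n T])%card.
Proof.
suff -> : [set S | sibling_portrait d G i P S] =
    vertex_sets @` [set T | @cyclic_portrait i n T].
  by apply: inj_card_eq => T T' _ _; exact: vertex_sets_inj.
apply/seteqP; split=> [S PS|_ [T PT <-]] /=; last exact/sibling_portrait_vertex_sets.
have [T ST] := sibling_portrait_is_vertex_sets PS.
by exists T => //; apply/sibling_portrait_vertex_sets; rewrite -ST.
Qed.

Lemma card_one_to_one_portraits :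
  ([set S | one_to_one_portrait d G i P S] #=
   [set T | @cyclic_portrait i n T /\ forall Q, Q \in T ->
     {in Q &, forall x y : 'I_(i * n), x = y %[mod n] -> x = y}])%card.
Proof.
have [_ c_inj _] := c_ccw; have [_ v_inj _] := v_ccw.
have injP T : (forall q, q \in vertex_sets T -> {in q &, injective (sigma d)}) <->
    (forall Q, Q \in T -> {in Q &, forall x y : 'I_(i * n), x = y %[mod n] -> x = y}).
  split=> [h Q QT x y xQ yQ xy|h _ /vertex_setsP[Q QT ->] _ _ /verticesP[x xQ ->] /verticesP[y yQ ->]].
    apply: c_inj; apply: (h (vertices c Q)); rewrite ?mem_vertex_sets ?mem_vertices //.
    by rewrite !sigma_c; congr v; apply/val_inj.
  by rewrite !sigma_c => /v_inj/(congr1 val) /= xy; rewrite (h Q QT x y).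
set C := (X in (_ #= X)%card).
suff -> : [set S | one_to_one_portrait d G i P S] = vertex_sets @` C.
  by apply: inj_card_eq => T T' _ _; exact: vertex_sets_inj.
apply/seteqP; split=> [S [PS inj]|_ [T [PT /injP inj] <-]] /=; last first.
  by split=> //; apply/sibling_portrait_vertex_sets.
have [T ST] := sibling_portrait_is_vertex_sets PS; rewrite ST in PS inj *.
by exists T => //; split; [apply/sibling_portrait_vertex_sets|apply/injP].
Qed.

End PortraitReduction.

(** * Increasing lifts of covering maps of curves *)

Section Parametrization.
Variable R : realType.
Implicit Types (g h : R -> plane R) (X Y : set (plane R)).

Lemma periodicz h (t : R) (k : int) : periodic h 1 -> h (t + k%:~R) = h t.
Proof.
move=> hP; case: k => m; first by rewrite periodicn.
by rewrite NegzE mulrNz -{2}(subrK m.+1%:R t) periodicn.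
Qed.

(** A counterclockwise parametrization identifies the curve with [R / Z]. *)
Lemma ccw_parametrization_eq h Y (s t : R) : ccw_parametrization h Y ->
  h s = h t -> exists k : int, s = t + k%:~R.
Proof.
move=> [_ hP _ h_inj _] hst.
have frac (u : R) : u - (Num.floor u)%:~R \in `[0, 1[.
  rewrite in_itv /=; have := Num.Theory.floor_le u; have := floorD1_gt u.
  by rewrite intrD => h1 h2; apply/andP; split; lra.
have hE (u : R) : h (u - (Num.floor u)%:~R) = h u by rewrite -mulrNz periodicz.
have := h_inj _ _ (frac s) (frac t); rewrite !hE => /(_ hst) e.
by exists (Num.floor s - Num.floor t); rewrite intrB; move: e; lra.
Qed.

Lemma ccw_parametrization_surj g X x : ccw_parametrization g X -> X x ->
  exists2 t : R, 0 <= t < 1 & x = g t.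
Proof.
by move=> [_ _ <- _ _] [t]; rewrite /= in_itv /= => t01 <-; exists t.
Qed.

Lemma ccw_parametrization_mem g X t : ccw_parametrization g X -> X (g t).
Proof.
move=> [_ gP <- _ _]; exists (t - (Num.floor t)%:~R).
  rewrite /= in_itv /=; have := Num.Theory.floor_le t; have := floorD1_gt t.
  by rewrite intrD => h1 h2; apply/andP; split; lra.
by rewrite -mulrNz periodicz.
Qed.

Section Lift.
Variables (f : plane R -> plane R) (X Y : set (plane R)).
Variables (g h : R -> plane R) (F : R -> R).
Hypotheses (gX : ccw_parametrization g X) (hY : ccw_parametrization h Y).
Hypotheses (F_cont : continuous F) (F_incr : {homo F : s t / s < t}).
Hypothesis fg : forall t, f (g t) = h (F t).

Lemma lift_le s t : (F s <= F t) = (s <= t).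
Proof. exact: (le_mono F_incr). Qed.

(** The parameters 0 and 1 give the same point of the curve, so the lift [F]
    moves by an integer between them. *)
Lemma lift_degree : exists m : nat, F 1 = F 0 + m%:R.
Proof.
have [_ gP _ _ _] := gX.
have : h (F 1) = h (F 0) by rewrite -!fg -[1]add0r gP.
move=> /(ccw_parametrization_eq hY)[[m|m] FE]; first by exists m.
have : F 0 < F 1 by apply: F_incr.
rewrite FE ltrDl NegzE mulrNz oppr_gt0 => h0; exfalso.
by move: h0; rewrite -[X in X < 0]/(m.+1%:R) ltrn0.
Qed.

Variables (m n : nat) (s : 'I_n -> R).
Hypotheses (n_gt0 : (0 < n)%N) (F1 : F 1 = F 0 + m%:R).
Hypothesis s_itv : forall k, F 0 <= s k < F 0 + 1.
Hypothesis s_incr : forall k l : 'I_n, (k < l)%N -> s k < s l.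

Let label (j : nat) : 'I_n := Ordinal (ltn_pmod j n_gt0).
Let u (j : nat) : R := s (label j) + (j %/ n)%:R.

Lemma lift_values_incr j j' : (j < j')%N -> u j < u j'.
Proof.
move=> jj'; rewrite /u.
have /andP[s0 s1] := s_itv (label j); have /andP[s0' s1'] := s_itv (label j').
have := leq_div2r n (ltnW jj'); rewrite leq_eqVlt => /orP[/eqP e|lt].
  rewrite e ltrD2r s_incr //=; have := divn_eq j n; have := divn_eq j' n.
  by rewrite e; lia.
have : (j %/ n).+1%:R <= (j' %/ n)%:R :> R by rewrite ler_nat.
by rewrite -natr1; lra.
Qed.

(** The lift [F] maps [[0, 1[] increasingly onto [[F 0, F 0 + m[], an interval that
    contains each parameter [s k] and its translates by [1, ..., m - 1]. Listed
    in increasing order, the preimages run [m] times through the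
    sequence [s]. *)
Lemma lift_fibers : exists t : 'I_(m * n) -> R,
  [/\ forall j, 0 <= t j < 1, forall j j' : 'I_(m * n), (j < j')%N -> t j < t j',
      forall j, f (g (t j)) = h (s (label j))
    & forall x k, X x -> f x = h (s k) -> exists2 j, x = g (t j) & label j = k].
Proof.
have [_ hP _ _ _] := hY.
have uF (j : 'I_(m * n)) : F 0 <= u j < F 1.
  have /andP[s0 s1] := s_itv (label j); rewrite F1 /u.
  have : (j %/ n).+1%:R <= m%:R :> R by rewrite ler_nat ltn_divLR.
  by rewrite -natr1 => h1; have := ler0n R (j %/ n); lra.
have ex (j : 'I_(m * n)) : exists t : R, 0 <= t < 1 /\ F t = u j.
  have /andP[u0 u1] := uF j; have F01 : F 0 <= F 1 by rewrite lift_le ler01.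
  have [||t] := @IVT R F 0 1 (u j) ler01.
  - exact: continuous_subspaceT.
  - by rewrite (min_idPl F01) (max_idPr F01) u0 ltW.
  rewrite in_itv /= => /andP[t0 t1] Ft; exists t; rewrite t0 lt_neqAle t1 andbT.
  by split=> //; apply: contraTneq u1 => t1'; rewrite -Ft t1' ltxx.
have [t tP] := boolp.choice ex; exists t; split.
- by move=> j; case: (tP j).
- move=> j j' jj'; rewrite ltNge -lift_le -ltNge (tP j).2 (tP j').2.
  exact: lift_values_incr.
- by move=> j; rewrite fg (tP j).2 /u (periodicz _ (Posz (j %/ n)%N) hP).
move=> x k Xx; have [r /andP[r0 r1] ->] := ccw_parametrization_surj gX Xx.
rewrite fg => /(ccw_parametrization_eq hY)[z Fr].
have /andP[s0 s1] := s_itv k.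
have Fr0 : F 0 <= F r by rewrite lift_le.
have Fr1 : F r < F 1 by exact: F_incr.
have z0 : 0 <= z.
  suff : (-1)%:~R < z%:~R :> R by rewrite ltr_int -lezD1 addNr.
  by rewrite mulrN1z; lra.
case: z z0 Fr => // q _ Fr; have qm : (q < m)%N.
  have Fr' : F r = s k + q%:R := Fr.
  by rewrite -(ltr_nat R); move: Fr' Fr1 F1 s0 => -> /[swap] ->; lra.
have kn := ltn_ord k; have jlt : (q * n + k < m * n)%N.
  by apply: leq_trans (leq_mul qm (leqnn n)); rewrite mulSn addnC ltn_add2r.
have lk : label (q * n + k) = k by apply/val_inj; rewrite /= modnMDl modn_small.
exists (Ordinal jlt) => //; congr g; apply/eqP; rewrite eq_le -(lift_le r) -(lift_le _ r).
by rewrite (tP _).2 /u lk /= divnMDl // divn_small // addn0 Fr lexx.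
Qed.

End Lift.
End Parametrization.

Section CoveringFibers.
Variable R : realType.
Implicit Types (f : plane R -> plane R) (X Y : set (plane R)).

(** Each sheet over a neighborhood of [y] contains exactly one preimage of [y]. *)
Lemma covering_fiber (i : nat) f X Y y : covering_map i f X Y -> Y y ->
  exists e : 'I_i -> plane R,
    injective e /\ (forall x, X x /\ f x = y <-> exists k, x = e k).
Proof.
move=> [_ _ cov] Yy; have [U [Uo Uy [V [Vo VD VE Vhom]]]] := cov y Yy.
have ex k : exists x, (X `&` V k) x /\ f x = y /\
    (forall x', (X `&` V k) x' -> f x' = y -> x' = x).
  have [g [_ _ _ gV [gf fg]]] := Vhom k.
  have YUy : (Y `&` U) y by [].
  exists (g y); split; first by apply: gV; exists y.
  by split=> [|x' x'V <-]; [exact: fg|rewrite gf].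
have [e eP] := boolp.choice ex; exists e; split=> [k l ekl|x].
  have [kV _] := eP k; have [lV _] := eP l; rewrite ekl in kV.
  by apply: VD => //; exists (e l).
split=> [[Xx fx]|[k ->]]; last by have [[Xe _] [fe _]] := eP k.
have : (X `&` f @^-1` U) x by split; rewrite // /preimage /= fx.
rewrite VE => -[k _ xV]; exists k; have [_ [_]] := eP k; exact.
Qed.

Lemma ccw_enum_parametrization g X N (t : 'I_N -> R) (t0 : R) :
  ccw_parametrization g X -> (forall j, t0 <= t j < t0 + 1) ->
  (forall j j' : 'I_N, (j < j')%N -> t j < t j') ->
  (forall j, unit_circle (g (t j))) -> ccw_enum (g \o t).
Proof.
move=> gX t_itv t_incr gt_circle.
have t_lt j j' : t j' < t j + 1.
  by have /andP[? ?] := t_itv j; have /andP[? ?] := t_itv j'; lra.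
have neq (j j' : 'I_N) : (j < j')%N -> g (t j) != g (t j').
  move=> jj'; apply/eqP => /(ccw_parametrization_eq gX)[k tE].
  have k0 : (k%:~R : R) < 0 by have := t_incr _ _ jj'; lra.
  have k1 : (-1)%:~R < (k%:~R : R) by rewrite mulrN1z; have := t_lt j j'; lra.
  move: k0 k1; rewrite -[X in _ < X -> _]/(0%:~R) !ltr_int.
  by case: k {tE} => [[|k]|[|k]].
split=> // [j j' /= e|a b d ab bd].
  by apply/val_inj; case: (ltngtP j j') => // /neq/eqP []; rewrite e.
have ad := ltn_trans ab bd; rewrite lt_neqAle eq_sym /=.
have [_ _ _ _ ccw] := gX.
apply/andP; split; last by apply: ccw; rewrite ?t_incr.
apply: circle_orient_neq0 => //.
- exact: neq.
- by rewrite eq_sym; exact: neq.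
- by rewrite eq_sym; exact: neq.
Qed.

Section Lift.
Variables (i : nat) (f : plane R -> plane R) (X Y : set (plane R)).
Variables (g h : R -> plane R) (F : R -> R).
Hypotheses (gX : ccw_parametrization g X) (hY : ccw_parametrization h Y).
Hypotheses (F_cont : continuous F) (F_incr : {homo F : s t / s < t}).
Hypothesis fg : forall t, f (g t) = h (F t).
Hypothesis f_cov : covering_map i f X Y.

(** A fiber has [i] points because the map is a covering with [i] sheets, and
    [F 1 - F 0] points because its lift is increasing. *)
Lemma covering_lift_degree : F 1 = F 0 + i%:R.
Proof.
have [m F1] := lift_degree gX hY F_incr fg.
have Yh : Y (h (F 0)) by exact: (ccw_parametrization_mem _ hY).
have [e [e_inj eP]] := covering_fiber f_cov Yh.
(* A single vertex, with parameter [F 0], makes the list of preimages a fiber. *)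
have [||t [t01 t_incr ft t_surj]] := @lift_fibers _ f X Y g h F gX hY F_cont
  F_incr fg m 1 (fun=> F 0) isT F1.
- by move=> k; rewrite lexx ltrDl ltr01.
- by move=> [[|//] ?] [[|//] ?].
have gt_inj : injective (g \o t).
  move=> j j' /= /(ccw_parametrization_eq gX)[k tE].
  have /andP[j0 j1] := t01 j; have /andP[j0' j1'] := t01 j'.
  have k0 : k = 0.
    have : (-1)%:~R < (k%:~R : R) by rewrite mulrN1z; lra.
    have : (k%:~R : R) < 1%:~R by lra.
    by rewrite !ltr_int; case: k {tE} => [[|k]|[|k]].
  have {}tE : t j = t j' by rewrite tE k0 addr0.
  by apply/val_inj; case: (ltngtP j j') => // /t_incr; rewrite tE ltxx.
suff -> : i = m by [].
have fwd j : exists k, g (t j) = e k.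
  by apply/eP; split; [exact: (ccw_parametrization_mem _ gX)|exact: ft].
have [a aP] := boolp.choice fwd.
have bwd k : exists j, e k = g (t j).
  have [Xe fe] : X (e k) /\ f (e k) = h (F 0) by apply/eP; exists k.
  by have [j -> _] := t_surj _ ord0 Xe fe; exists j.
have [b bP] := boolp.choice bwd.
have a_inj : injective a by move=> j j' E; apply: gt_inj; rewrite /= !aP E.
have b_inj : injective b by move=> k k' E; apply: e_inj; rewrite !bP E.
apply/eqP; rewrite eqn_leq.
have := leq_card a a_inj; have := leq_card b b_inj.
by rewrite !card_ord muln1 => -> ->.
Qed.

(** Sorting the parameters of the vertices of [P] in a period of the parametrization
    of [Y], and then lifting them, lists the vertices and their preimages in
    counterclockwise order. *)
Lemma polygon_enumeration (n : nat) (P : polygon R) (n_gt0 : (0 < n)%N) :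
  #|` P| = n -> [set` P] `<=` Y -> [set` P] `<=` unit_circle ->
  (forall x, X x -> f x \in P -> unit_circle x) ->
  exists (v : 'I_n -> plane R) (c : 'I_(i * n) -> plane R),
  [/\ ccw_enum v, P = vertices v [set: 'I_n]%SET, ccw_enum c
    & [/\ forall j, X (c j),
          forall j : 'I_(i * n), f (c j) = v (Ordinal (ltn_pmod j n_gt0))
        & forall x, X x -> f x \in P -> exists j, x = c j]].
Proof.
move=> cP PY Pcirc Xcirc; have hP : periodic h 1 by case: hY.
have ex y : exists s : R, y \in P -> F 0 <= s < F 0 + 1 /\ y = h s.
  have [/PY/(ccw_parametrization_surj hY)[s /andP[s0 s1] ->]|_] := boolP (y \in P);
    last by exists 0.
  (* The translate of [s] in [[F 0, F 0 + 1[] is [s] plus the ceiling of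
     [F 0 - s], which is [z], or [z - 1] when [F 0 - s] is an integer. *)
  pose z := Num.floor (F 0 - s) + 1.
  have zl : F 0 - s < z%:~R by rewrite /z floorD1_gt.
  have zu : z%:~R <= F 0 - s + 1 by rewrite /z intrD lerD2r Num.Theory.floor_le.
  have [zE|zE] := eqVneq (z%:~R : R) (F 0 - s + 1).
    exists (s + (z - 1)%:~R) => _; rewrite periodicz //; split=> //.
    by rewrite intrB zE; lra.
  exists (s + z%:~R) => _; rewrite periodicz //; split=> //.
  have : z%:~R < F 0 - s + 1 by rewrite lt_neqAle zE.
  by move=> ?; apply/andP; split; lra.
have [tau tauP] := boolp.choice ex.
pose sl := sort <=%O [seq tau y | y <- P].
have sl_mem r : reflect (exists2 y, y \in P & r = tau y) (r \in sl).
  by rewrite mem_sort; exact: mapP.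
have sl_size : size sl = n by rewrite size_sort size_map.
have sl_uniq : uniq sl.
  rewrite sort_uniq map_inj_in_uniq ?fset_uniq // => y y' yP y'P e.
  by rewrite (tauP y yP).2 (tauP y' y'P).2 e.
have sl_sorted : sorted <%O sl by rewrite lt_sorted_uniq_le sl_uniq sort_le_sorted.
pose s (k : 'I_n) := nth 0 sl k.
have s_mem k : s k \in sl by rewrite mem_nth // sl_size.
have s_itv k : F 0 <= s k < F 0 + 1.
  by have /sl_mem[y /tauP[]] := s_mem k => ? _ ->.
have s_incr (k l : 'I_n) : (k < l)%N -> s k < s l.
  by move=> kl; rewrite /s lt_sorted_ltn_nth // inE sl_size.
have hsP k : h (s k) \in P.
  by have /sl_mem[y yP ->] := s_mem k; rewrite -(tauP y yP).2.
have Psurj y : y \in P -> exists k, y = h (s k).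
  move=> yP; have ys : tau y \in sl by apply/sl_mem; exists y.
  have ilt : (index (tau y) sl < n)%N by rewrite -sl_size index_mem.
  by exists (Ordinal ilt); rewrite /s /= nth_index //; case: (tauP y yP).
have [t [t01 t_incr ft t_surj]] :=
  lift_fibers gX hY F_cont F_incr fg n_gt0 covering_lift_degree s_itv s_incr.
have v_ccw : ccw_enum (h \o s).
  by apply: (ccw_enum_parametrization hY s_itv) => // k; apply: Pcirc; exact: hsP.
have Xgt j : X (g (t j)) by exact: (ccw_parametrization_mem _ gX).
exists (h \o s), (g \o t); split=> //.
- apply/fsetP => y; apply/idP/verticesP => [/Psurj[k ->]|[k _ ->]]; last exact: hsP.
  by exists k; rewrite ?finset.in_setT.
- apply: (ccw_enum_parametrization gX (t0 := 0)) => // [j|j].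
    by rewrite add0r.
  by apply: Xcirc => //; rewrite ft.
split=> // x Xx fx; have [k fxk] := Psurj _ fx.
by have [j -> _] := t_surj x k Xx fxk; exists j.
Qed.

End Lift.
End CoveringFibers.

(** * Topology of the plane *)

Section PlaneTopology.
Variable R : realType.
Implicit Types (a b x y z : plane R) (t : R) (A C : set (plane R)).

Lemma continuous_orient a b : continuous (orient a b : plane R -> R).
Proof.
move=> x; rewrite /orient.
apply: cvgB; apply: cvgM; try exact: cvg_cst.
  by apply: cvgB; [exact: cvg_snd|exact: cvg_cst].
by apply: cvgB; [exact: cvg_fst|exact: cvg_cst].
Qed.

Lemma continuous_sqnorm : continuous (fun x : plane R => x.1 ^+ 2 + x.2 ^+ 2 : R).
Proof.
move=> x; apply: cvgD; rewrite /= !expr2; apply: cvgM; try exact: cvg_fst;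
  exact: cvg_snd.
Qed.

Lemma continuous_segment x y :
  continuous (fun t : R => (1 - t) *: x + t *: y : plane R).
Proof.
move=> t; apply: cvgD; apply: cvgZr_tmp; last exact: cvg_id.
by apply: cvgB; [exact: cvg_cst|exact: cvg_id].
Qed.

Lemma closed_disk : closed (@unit_disk R).
Proof.
exact: (proj1 (continuous_closedP _) continuous_sqnorm _ (@closed_le R 1)).
Qed.

Lemma closed_left a b : closed [set z : plane R | 0 <= orient a b z].
Proof.
exact: (proj1 (continuous_closedP _) (@continuous_orient a b) _ (@closed_ge R 0)).
Qed.

Lemma connected_segment x y : connected (chord x y).
Proof.
have -> : chord x y = (fun t : R => (1 - t) *: x + t *: y) @` `[0, 1].
  apply/seteqP; split=> [z [t t01 ->]|_ [t t01 <-]] /=.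
    by exists t; rewrite //= in_itv.
  by exists t => //; move: t01; rewrite /= in_itv.
apply: connected_continuous_connected.
  by apply/connected_intervalP; exact: interval_is_interval.
by apply: continuous_subspaceT; exact: continuous_segment.
Qed.

Lemma convex_closure C : convex_set C -> convex_set (closure C).
Proof.
move=> /convex_setP cC; apply/convex_setP => x y t t01 clx cly U.
have ct : continuous (fun p : plane R * plane R =>
    (1 - t) *: p.1 + t *: p.2 : plane R).
  by move=> p; apply: cvgD; apply: cvgZl_tmp; [exact: cvg_fst|exact: cvg_snd].
move=> /(ct (x, y))[[V W] /= [Vx Wy] VW].
have [x' [Cx' Vx']] := clx V Vx; have [y' [Cy' Wy']] := cly W Wy.
exists ((1 - t) *: x' + t *: y'); split; first exact: cC.
exact: (VW (x', y')).
Qed.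

(** Points just beyond [x] on its ray from the origin are outside the disk. *)
Lemma circle_not_interior A x : A `<=` unit_disk -> unit_circle x -> ~ A° x.
Proof.
move=> Ad xc; rewrite /interior /= => Ax.
have ct : continuous (fun t : R => (1 - t) *: (0 : plane R) + t *: x).
  exact: continuous_segment.
have /ct : nbhs ((1 - 1) *: (0 : plane R) + (1 : R) *: x) A.
  by rewrite subrr scale0r scale1r add0r.
move=> /nbhs_ballP[e /= e0 eA].
have /Ad : A ((1 - (1 + e / 2)) *: (0 : plane R) + (1 + e / 2) *: x).
  apply: (eA (1 + e / 2)); rewrite /ball /= opprD addrA subrr sub0r normrN gtr0_norm; lra.
rewrite /unit_disk /= /GRing.scale /= !mulr0 !add0r !exprMn -mulrDr.
by rewrite xc mulr1; nra.
Qed.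

(** Moving [x] to the right of the line leaves the half-plane. *)
Lemma line_not_interior A a b x : A `<=` [set z | 0 <= orient a b z] ->
  a != b -> orient a b x = 0 -> ~ A° x.
Proof.
move=> Ao ab ox; rewrite /interior /= => Ax.
(* The vector from [x] to [y] is normal to the line and points to its right. *)
pose y : plane R := (x.1 + (b.2 - a.2), x.2 - (b.1 - a.1)).
have ct : continuous (fun t : R => (1 - t) *: x + t *: y).
  exact: continuous_segment.
have /ct : nbhs ((1 - 0) *: x + (0 : R) *: y) A.
  by rewrite subr0 scale0r scale1r addr0.
move=> /nbhs_ballP[e /= e0 eA].
have /Ao : A ((1 - e / 2) *: x + (e / 2) *: y).
  by apply: (eA (e / 2)); rewrite /ball /= sub0r normrN gtr0_norm; lra.
rewrite /= orient_convex ox mulr0 add0r.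
have -> : orient a b y = - ((b.1 - a.1) ^+ 2 + (b.2 - a.2) ^+ 2) + orient a b x.
  by rewrite /orient /y /=; ring.
have := neq_sqdist ab; rewrite ox; nra.
Qed.

(** From a point of the circle that is off [Y], a ray escapes to infinity
    outside the disk, so its component is unbounded. *)
Lemma filled_circle (Y : set (plane R)) (v : plane R) : Y `<=` unit_disk -> filled Y v -> unit_circle v -> Y v.
Proof.
move=> Yd [//|[nYv bd]] vc; exfalso.
pose ray := (fun t : R => (1 - t) *: (0 : plane R) + t *: v) @` `[1, +oo[.
have rayE t : (1 - t) *: (0 : plane R) + t *: v = t *: v.
  by rewrite scaler0 add0r.
have ray_out : ray `<=` ~` Y.
  move=> _ [t + <-]; rewrite /= in_itv /= andbT rayE => t1 Yt.
  have := Yd _ Yt; rewrite /unit_disk /= /GRing.scale /= !exprMn -mulrDr vc mulr1 => t2.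
  have tE : t = 1 by nra.
  by move: Yt; rewrite tE scale1r.
have ray_conn : connected ray.
  apply: connected_continuous_connected.
    by apply/connected_intervalP; exact: interval_is_interval.
  by apply: continuous_subspaceT; exact: continuous_segment.
have vray : ray v by exists 1; rewrite ?rayE ?scale1r //= in_itv /= lexx.
have sub := connected_component_max vray ray_out ray_conn.
have v0 : 0 < `|v|.
  rewrite normr_gt0; apply/eqP => v0; move: vc; rewrite v0 /unit_circle /=.
  by rewrite expr0n /= addr0 => /esym/eqP; rewrite oner_eq0.
move: bd => [M [_ /(_ (`|M| + 1))]] bd.
have /bd : M < `|M| + 1 by rewrite (le_lt_trans (ler_norm _)) // ltrDl.
move=> {}bd; (* A point of the ray with norm greater than the bound [`|M| + 1]. *)
pose t := (`|M| + 1) / `|v| + 1.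
have t1 : 1 <= t by rewrite /t lerDr divr_ge0 // addr_ge0.
have /sub /bd : ray (t *: v) by exists t; rewrite ?rayE //= in_itv /= t1.
rewrite /= normrZ ger0_norm ?(le_trans ler01) // /t mulrDl divfK ?gt_eqF // mul1r.
by lra.
Qed.

End PlaneTopology.

(** * Round gaps *)

Section Gap.
Variables (R : realType) (d : nat) (L : set (plane R * plane R)).
Hypothesis hL : lamination L.
Implicit Types (a b p q x y z : plane R) (t : R).

Lemma leaf_circle a b : L (a, b) -> unit_circle a /\ unit_circle b.
Proof. by case: hL => h _ _ _ _; exact: h. Qed.

Lemma sigma_ext_circle x : unit_circle x -> sigma_ext d L x = sigma d x.
Proof.
move=> xc; have Lx : L (x, x) by case: hL => _ _ h _ _; exact: h.
have := @sigma_ext_chord _ d L x x 0 hL Lx; rewrite !subr0 !scale1r !scale0r !addr0.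
by apply; rewrite lexx ler01.
Qed.

Lemma sigma_on_circle x : unit_circle (sigma d x).
Proof. by rewrite /unit_circle /sigma /circ /= cos2Dsin2. Qed.

(** Off the leaves, [sigma_ext] takes its default value, the point itself. *)
Variant sigma_ext_spec x : plane R -> Prop :=
  | SigmaExtLeaf a b t of L (a, b) & 0 <= t <= 1 & x = (1 - t) *: a + t *: b :
      sigma_ext_spec x ((1 - t) *: sigma d a + t *: sigma d b)
  | SigmaExtOut : sigma_ext_spec x x.

Lemma sigma_extP x : sigma_ext_spec x (sigma_ext d L x).
Proof.
rewrite /sigma_ext; case: xgetP => [_ _ [a [b [t [Lab t01 xE ->]]]]|_].
  exact: (SigmaExtLeaf Lab t01 xE).
exact: SigmaExtOut.
Qed.

Lemma sigma_ext_disk x : unit_disk x -> unit_disk (sigma_ext d L x).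
Proof.
move=> xd; case: sigma_extP => // a b t _ t01 _.
by apply: disk_convex_comb => //; apply: circle_disk; exact: sigma_on_circle.
Qed.

Section Component.
Variable x0 : plane R.
Let U : set (plane R) := unit_disk `\` Defs.support L.
Hypothesis Ux0 : U x0.
Let C := connected_component U x0.
Let G := closure C.

(** The points of the circle are degenerate leaves. *)
Lemma component_open_disk z : U z -> z.1 ^+ 2 + z.2 ^+ 2 < 1.
Proof.
move=> [zd zS]; rewrite lt_neqAle; apply/andP; split; last exact: zd.
apply/eqP => zc; apply: zS; exists z, z; split.
  by case: hL => _ _ h _ _; exact: h.
by exists 0; rewrite ?lexx ?ler01 // subr0 scale1r scale0r addr0.
Qed.

(** The disk is strictly convex. *)
Lemma open_disk_segment x y t : x.1 ^+ 2 + x.2 ^+ 2 < 1 -> unit_disk y ->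
  0 <= t < 1 -> ~ unit_circle ((1 - t) *: x + t *: y).
Proof.
rewrite /unit_disk /unit_circle /= /GRing.scale /= => dx dy /andP[t0 t1].
have : 0 <= t * (1 - t) * ((y.1 - x.1) ^+ 2 + (y.2 - x.2) ^+ 2).
  by rewrite mulr_ge0 ?addr_ge0 ?sqr_ge0 // mulr_ge0 // subr_ge0 ltW.
set u := (X in X = 1).
have -> : u = (1 - t) * (x.1 ^+ 2 + x.2 ^+ 2) + t * (y.1 ^+ 2 + y.2 ^+ 2)
  - t * (1 - t) * ((y.1 - x.1) ^+ 2 + (y.2 - x.2) ^+ 2) by rewrite /u; ring.
move=> ? ?; nra.
Qed.

Lemma component_off_line a b z : L (a, b) -> a != b -> U z -> orient a b z != 0.
Proof.
move=> Lab ab [zd zS]; have [ac bc] := leaf_circle Lab.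
by apply/eqP => o; apply: zS; exists a, b; split=> //; exact: disk_line_chord.
Qed.

(** The component is connected and avoids the leaf, which is the whole part of
    its line in the disk. *)
Lemma component_same_side a b z : L (a, b) -> a != b -> C z ->
  0 < orient a b x0 -> 0 < orient a b z.
Proof.
move=> Lab ab Cz ox0; rewrite ltNge; apply/negP => oz.
have conn : connected (orient a b @` C).
  apply: connected_continuous_connected; first exact: component_connected.
  by apply: continuous_subspaceT; exact: continuous_orient.
have [u Cu ou] : (orient a b @` C) 0.
  move/connected_intervalP: conn => /(_ (orient a b z) (orient a b x0)); apply.
  - by exists z.
  - by exists x0 => //; exact: connected_component_refl.
  - by rewrite oz ltW.
have := component_off_line Lab ab (connected_component_sub Cu).
by rewrite ou eqxx.
Qed.

Lemma gap_side a b z : L (a, b) -> a != b -> 0 < orient a b x0 -> G z ->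
  0 <= orient a b z.
Proof.
move=> Lab ab ox0; rewrite /G closureE.
apply: (smallest_sub (@closed_left _ a b)) => w Cw.
by apply/ltW; exact: component_same_side.
Qed.

Lemma chordC a b : chord a b = chord b a.
Proof.
have sub p q : chord p q `<=` chord q p.
  move=> _ [t /andP[t0 t1] ->]; exists (1 - t); first by apply/andP; split; lra.
  by rewrite subKr addrC.
by apply/seteqP; split; exact: sub.
Qed.

Lemma leaf_positive_side a b : L (a, b) -> a != b ->
  exists p q, [/\ L (p, q), p != q, chord p q = chord a b,
    (a, b) = (p, q) \/ (a, b) = (q, p) & 0 < orient p q x0].
Proof.
move=> Lab ab; have := component_off_line Lab ab Ux0.
rewrite neq_lt => /orP[neg|pos]; last by exists a, b; split=> //; left.
exists b, a; split; [|by rewrite eq_sym|exact: chordC|by right|].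
  by case: hL => _ h _ _ _; exact: h.
by rewrite orient_swap oppr_gt0.
Qed.

Lemma chordaa a z : chord a a z -> z = a.
Proof. by move=> [t _ ->]; rewrite -scalerDl subrK scale1r. Qed.

Lemma chord_orient a b z : chord a b z -> orient a b z = 0.
Proof. by move=> [t _ ->]; exact: orient_line. Qed.

Lemma component_segment x y : C x -> chord x y `<=` U -> chord x y `<=` C.
Proof.
move=> Cx sub; rewrite /C (same_connected_component Cx).
apply: (connected_component_max _ sub); last exact: connected_segment.
by exists 0; rewrite ?lexx ?ler01 // subr0 scale1r scale0r addr0.
Qed.

(** A segment between two points of the component has all its points on the same
    strict side of each leaf as its ends, so it meets no leaf. *)
Lemma component_convex : convex_set C.
Proof.
apply/convex_setP => x y t t01 Cx Cy.
have Ux := connected_component_sub Cx; have Uy := connected_component_sub Cy.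
suff sub : chord x y `<=` U by apply: (component_segment Cx sub); exists t.
move=> _ [s s01 ->]; have dz : unit_disk ((1 - s) *: x + s *: y).
  by apply: disk_convex_comb => //; [case: Ux|case: Uy].
split=> // -[a [b [Lab]]]; have [ac _] := leaf_circle Lab.
have [<- /chordaa e|ab] := eqVneq a b.
  have [s1|s1] := eqVneq s 1.
    have ya : y = a by rewrite -e s1 subrr scale0r add0r scale1r.
    have := component_open_disk Uy; rewrite ya.
    by rewrite [_ + _](ac : _ = _) ltxx.
  move: ac; rewrite -e; apply: open_disk_segment; first exact: component_open_disk.
    by case: Uy.
  by move: s01; rewrite lt_neqAle s1.
have [p [q [Lpq pq <- _ o0]]] := leaf_positive_side Lab ab.
move=> /chord_orient; rewrite orient_convex.
have := component_same_side Lpq pq Cx o0; have := component_same_side Lpq pq Cy o0.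
by move: s01 => /andP[? ?]; nra.
Qed.

Lemma gap_convex : convex_set G.
Proof. exact/convex_closure/component_convex. Qed.

Lemma gap_disk : G `<=` unit_disk.
Proof.
rewrite /G closureE; apply: (smallest_sub (@closed_disk _)).
by move=> z /connected_component_sub[].
Qed.

Lemma gap_circle_boundary x : G x -> unit_circle x -> boundary G x.
Proof.
move=> Gx xc; split; first exact: subset_closure.
exact: (circle_not_interior gap_disk).
Qed.

Lemma boundary_gap x : boundary G x -> G x.
Proof. by move=> []; rewrite -(proj1 (closure_id G)) //; exact: closed_closure. Qed.

(** A leaf [p q] that meets the segment from [x0] to [a] before [a]
    separates [x0] from [a]. The point [x], which is in the closure of the
    component of [x0], is not beyond [p q], so that [p q] meets the leaf [a b]
    between [x] and [a]. Distinct leaves cannot meet there, and [a] is not on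
    the line of [p q]. *)
Lemma leaf_endpoint_segment a b x s : L (a, b) -> a != b -> G x ->
  chord a b x -> ~ unit_circle x -> 0 <= s < 1 -> U ((1 - s) *: x0 + s *: a).
Proof.
move=> Lab ab Gx xab xc /andP[s0 s1]; have [ac bc] := leaf_circle Lab.
have x0d := component_open_disk Ux0.
split; first by apply: disk_convex_comb; [case: Ux0|exact: circle_disk|rewrite s0 ltW].
move=> [p1 [q1 [Lpq1]]]; have [pc1 _] := leaf_circle Lpq1.
have [<- /chordaa e|pq1] := eqVneq p1 q1.
  by move: pc1; rewrite -e; apply: open_disk_segment; rewrite ?s0 //; exact: circle_disk.
have [p [q [Lpq pq <- _ o0]]] := leaf_positive_side Lpq1 pq1.
have [pc qc] := leaf_circle Lpq.
move=> /chord_orient; rewrite orient_convex => o.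
have oa : orient p q a < 0 by nra.
have ox : 0 <= orient p q x by exact: gap_side Gx.
pose D := orient p q x - orient p q a.
have D0 : 0 < D by rewrite /D; lra.
(* The point [w] is the intersection of the line through [p] and [q] with the
   segment from [x] to [a]; it equals [x] when [x] is on this line. *)
pose r := orient p q x / D; pose w := (1 - r) *: x + r *: a.
have r0 : 0 <= r by rewrite divr_ge0 // ltW.
have r1 : r < 1 by rewrite ltr_pdivrMr // mul1r /D; lra.
have ow : orient p q w = 0.
  by rewrite orient_convex /r /D; field; rewrite -/D gt_eqF.
have xd : x.1 ^+ 2 + x.2 ^+ 2 < 1.
  by rewrite lt_neqAle; apply/andP; split; [exact/eqP|exact: gap_disk].
have wc : ~ unit_circle w.
  by apply: open_disk_segment; rewrite ?r0 //; exact: circle_disk.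
have wd : unit_disk w.
  by apply: disk_convex_comb; rewrite ?r0 ?ltW //; [exact: ltW|exact: circle_disk].
have wpq : chord p q w by exact: disk_line_chord.
have wab : chord a b w.
  case: xab => t /andP[t0 t1] xE; exists ((1 - r) * t).
    by apply/andP; split; nra.
  rewrite /w xE; apply: plane_eqP; rewrite /= /GRing.scale /=; ring.
have [_ _ _ _ /(_ a b p q Lab Lpq) [[pa _]|[_ qa]|cr]] := hL.
- by move: oa; rewrite pa -orient_rot -orient_rot orientaa ltxx.
- by move: oa; rewrite qa -orient_rot orientaa ltxx.
- by have [[we|we] _] := cr w (conj wab wpq); apply: wc; rewrite we.
Qed.

(** The segment from [x0] to [a] stays in the component until it reaches [a]. *)
Lemma leaf_endpoint a b x : L (a, b) -> a != b -> G x -> chord a b x ->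
  ~ unit_circle x -> G a.
Proof.
move=> Lab ab Gx xab xc V.
have ct := @continuous_segment _ x0 a.
have E1 : (1 - 1) *: x0 + (1 : R) *: a = a by rewrite subrr scale0r scale1r add0r.
rewrite -{1}E1 => /ct /nbhs_ballP[e /= e0 eV].
pose s := Num.max 0 (1 - e / 2).
have s01 : 0 <= s < 1 by rewrite /s le_max lexx /= gt_max ltr01 /=; lra.
exists ((1 - s) *: x0 + s *: a); split.
  have [_ s1] := andP s01; have := connected_component_refl Ux0.
  move=> Cx0; apply: (component_segment Cx0 (y := (1 - s) *: x0 + s *: a)); last first.
    by exists 1; rewrite ?lexx ?ler01 // subrr scale1r scale0r add0r.
  move=> _ [r /andP[r0 r1] ->].
  have -> : (1 - r) *: x0 + r *: ((1 - s) *: x0 + s *: a) =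
      (1 - r * s) *: x0 + (r * s) *: a.
    by apply: plane_eqP; rewrite /= /GRing.scale /=; ring.
  by apply: (leaf_endpoint_segment Lab ab Gx xab xc); apply/andP; split; nra.
apply: eV; rewrite /ball /= ger0_norm ?subr_ge0 ?ltW //; last by case/andP: s01.
have : 1 - e / 2 <= s by rewrite le_max lexx orbT.
by lra.
Qed.

(** The gap contains the leaf by convexity, and lies on one side of it. *)
Lemma leaf_boundary a b x : L (a, b) -> a != b -> G x -> chord a b x ->
  ~ unit_circle x -> chord a b `<=` boundary G.
Proof.
move=> Lab ab Gx xab xc _ [t t01 ->].
have Lba : L (b, a) by case: hL => _ h _ _ _; exact: h.
have Ga := leaf_endpoint Lab ab Gx xab xc.
have Gb : G b by apply: leaf_endpoint Lba _ Gx _ xc; rewrite 1?eq_sym // chordC.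
have Gz : G ((1 - t) *: a + t *: b).
  exact: (proj1 (convex_setP _) gap_convex).
split; first exact: subset_closure.
have [p [q [Lpq pq _ E o0]]] := leaf_positive_side Lab ab.
apply: (@line_not_interior _ _ p q) => //.
  by move=> z; exact: gap_side.
by case: E => -[-> ->]; rewrite ?orient_line // orient_swap orient_line oppr0.
Qed.

(** An affine combination of two distinct points of the circle is on the circle
    only at the ends. So a point off the circle that maps to the circle lies on
    a leaf whose ends have the same image. This leaf is a part of the boundary
    that collapses to a point, and it has more than [i] points. *)
Lemma preimage_on_circle i x :
  covering_map i (sigma_ext d L) (boundary G) (sigma_ext d L @` boundary G) ->
  boundary G x -> unit_circle (sigma_ext d L x) -> unit_circle x.
Proof.
move=> cov bx; have := erefl (sigma_ext d L x).
case: {2 3}_ / sigma_extP => // a b t Lab t01 xE fx fc.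
have [ac bc] := leaf_circle Lab.
have [ab|ab] := eqVneq a b.
  by rewrite xE -ab -scalerDl subrK scale1r.
have [sab|sab] := eqVneq (sigma d a) (sigma d b); last first.
  have [t0|t1] := circle_chord_end (sigma_on_circle a) (sigma_on_circle b) sab fc.
    by rewrite xE t0 subr0 scale1r scale0r addr0.
  by rewrite xE t1 subrr scale1r scale0r add0r.
apply: contrapT => xc; have Gx := boundary_gap bx.
have xab : chord a b x by exists t.
have sub := leaf_boundary Lab ab Gx xab xc.
have [|e [e_inj eP]] := covering_fiber cov (y := sigma_ext d L x).
  by exists x.
(* These are [i + 1] points of the leaf, one more than a fiber contains. *)
pose s (k : 'I_i.+1) : R := k%:R / i.+1%:R.
have s01 k : 0 <= s k <= 1.
  rewrite divr_ge0 //= ler_pdivrMr ?ltr0n // mul1r ler_nat; exact/ltnW/ltn_ord.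
have ex k : exists l, (1 - s k) *: a + s k *: b = e l.
  apply/eP; split; first by apply: sub; exists (s k).
  rewrite (sigma_ext_chord _ hL Lab (s01 k)) fx sab.
  by rewrite -!scalerDl !subrK.
have [l lP] := boolp.choice ex.
have l_inj : injective l.
  move=> k k' E; have := lP k; rewrite E -lP => e0.
  have : (s k - s k') *: (b - a) = 0.
    by apply: plane_eqP; [have := congr1 fst e0|have := congr1 snd e0];
      rewrite /= /GRing.scale /=; lra.
  move/eqP; rewrite scaler_eq0 !subr_eq0 [b == a]eq_sym (negPf ab) orbF => /eqP.
  move/(mulIf (invr_neq0 (lt0r_neq0 (ltr0Sn R i))))/eqP.
  by rewrite eqr_nat => /eqP/val_inj.
by have := leq_card l l_inj; rewrite !card_ord ltnn.
Qed.

End Component.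

(** The interface between gaps and partitions: the set of portraits has the
    cardinality of a set that depends on [i] and [n] only. *)
Lemma gap_portrait_cards G i n P : round_gap L G -> gap_degree d L G i ->
  (1 < n)%N -> ngon n P -> polygon_region P `<=` gap_image d L G ->
  ([set S | sibling_portrait d G i P S] #= [set T | @cyclic_portrait i n T])%card /\
  ([set S | one_to_one_portrait d G i P S] #=
   [set T | @cyclic_portrait i n T /\ forall Q, Q \in T ->
     {in Q &, forall x y : 'I_(i * n), x = y %[mod n] -> x = y}])%card.
Proof.
move=> [[x0 Ux0 GE] _] [cov [g [h [F [gX hY F_cont F_incr fg]]]]] n1 [Pc _ Pn] PG.
have Gd : G `<=` unit_disk by rewrite GE; exact: gap_disk.
have bG x : boundary G x -> G x by rewrite GE; exact: boundary_gap.
have Gb x : G x -> unit_circle x -> boundary G x.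
  by rewrite GE; exact: gap_circle_boundary.
have Xc x : boundary G x -> sigma_ext d L x \in P -> unit_circle x.
  by move=> bx fx; move: cov bx (Pc _ fx); rewrite GE; exact: preimage_on_circle.
have PY : [set` P] `<=` sigma_ext d L @` boundary G.
  move=> v vP; apply: filled_circle (Pc _ vP).
    by move=> _ [x bx <-]; apply: sigma_ext_disk; apply: Gd; exact: bG.
  by apply: PG; apply: sub_gen_smallest.
have [v [c [v_ccw Pv c_ccw [cX fc c_surj]]]] :=
  polygon_enumeration gX hY F_cont F_incr fg cov (ltnW n1) Pn PY Pc Xc.
have G_convex : convex_set G by rewrite GE; exact: gap_convex.
have cc j : unit_circle (c j) by case: c_ccw.
have sc j : sigma d (c j) = v (Ordinal (ltn_pmod j (ltnW n1))).
  by rewrite -fc sigma_ext_circle.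
have cs x : G x -> unit_circle x -> sigma d x \in P -> exists j, x = c j.
  by move=> Gx xc xP; apply: c_surj; [exact: Gb|rewrite sigma_ext_circle].
have cG j : G (c j) by exact: bG.
split.
  exact: (@card_sibling_portraits _ _ _ _ n1 _ _ _ _ G_convex v_ccw Pv c_ccw sc cs cG).
exact: (@card_one_to_one_portraits _ _ _ _ n1 _ _ _ _ G_convex v_ccw Pv c_ccw sc cs cG).
Qed.

End Gap.

Unset Implicit Arguments.

Theorem theorem3p2 (R : realType) (i n : nat) (hi : (1 <= i)%N) (hn : (2 <= n)%N)
  (d : nat) (hd : (2 <= d)%N)
  (L : set (plane R * plane R)) (hL : lamination L)
  (G : set (plane R)) (hG : round_gap L G) (hGi : gap_degree d L G i)
  (P : polygon R) (hP : ngon n P) (hPG : polygon_region P `<=` gap_image d L G)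
  (d' : nat) (hd' : (2 <= d')%N)
  (L' : set (plane R * plane R)) (hL' : lamination L')
  (G' : set (plane R)) (hG' : round_gap L' G') (hGi' : gap_degree d' L' G' i)
  (P' : polygon R) (hP' : ngon n.+1 P')
  (hPG' : polygon_region P' `<=` gap_image d' L' G') :
  exists N : nat,
    ([set S | sibling_portrait d G i P S] #= `I_N)%card /\
    ([set S | one_to_one_portrait d' G' i P' S] #= `I_N)%card.
Proof.
have [N [FN fN]] := card_cyclic_portraits i hn; exists N.
have [sib _] := gap_portrait_cards hL hG hGi hn hP hPG.
have [_ one] := gap_portrait_cards hL' hG' hGi' (leqW hn) hP' hPG'.
by split; [exact: card_eq_trans sib FN|exact: card_eq_trans one fN].
Qed.
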